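(* Let $\mathcal H=(V,E)$ be an $r$-uniform hypergraph with $n$ vertices and $m$ edges, where $r\ge 3$ and $m\ge 5$. If $\gamma(\mathcal H)\le 0.8(m-1)$, then for any integer $k\ge 0.6(m-1)+0.5\gamma(\mathcal H)$ and any $k$-assignment $L$ of $\mathcal H$, $$P(\mathcal H,L)-P(\mathcal H,k)\ge 0.02\, k^{n-r}\,\alpha(\mathcal H,L),$$ and therefore $\tau'(\mathcal H)\le 0.6(m-1)+0.5\gamma(\mathcal H)\le m-1$.
   Context: All hypergraphs $\mathcal H=(V,E)$ are finite; every edge has at least $2$ vertices and no edge is contained in another edge. $\mathcal H$ is $r$-uniform if every edge has exactly $r$ vertices. For $k\in\mathbb N$ and $[k]=\{1,\dots,k\}$, a proper $k$-coloring of $\mathcal H$ is a map $\theta:V\to[k]$ such that $|\{\theta(v):v\in e\}|\ge 2$ for every edge $e$; $P(\mathcal H,k)$ is the number of proper $k$-colorings. A $k$-assignment $L$ of $\mathcal H$ assigns to each vertex $v$ a set $L(v)\subseteq\mathbb N$ with $|L(v)|=k$; an $L$-coloring is a map $\theta$ with $\theta(v)\in L(v)$ for all $v$ and $|\{\theta(v):v\in e\}|\ge2$ for every edge $e$; $P(\mathcal H,L)$ is the number of $L$-colorings. $\tau'(\mathcal H)$ is the smallest positive integer $q$ such that $P_l(\mathcal H,k)=P(\mathcal H,k)$ for all integers $k\ge q$, where $P_l(\mathcal H,k)=\min_L P(\mathcal H,L)$ over all $k$-assignments $L$. For an edge $e$ of an $r$-uniform $\mathcal H$, $E_{r-1}(e)$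 is the set of edges $e'$ with $|e\cap e'|=r-1$, and $\gamma(\mathcal H)=\max_{e\in E}|E_{r-1}(e)|$. For a $k$-assignment $L$, $\alpha(e,L)=k-\left|\bigcap_{v\in e}L(v)\right|$ and $\alpha(\mathcal H,L)=\sum_{e\in E}\alpha(e,L)$. *)

(* Defs.v *)
From HB Require Import structures.
From mathcomp Require Import all_boot all_order all_algebra finmap boolp.
Set Implicit Arguments.
Unset Strict Implicit.
Unset Printing Implicit Defensive.

Local Open Scope fset_scope.

Record hypergraph := Hypergraph {
  vertex :> finType;
  edges : {set {set vertex}};
  edge_card : {in edges, forall e : {set vertex}, 1 < #|e|};
  edge_antichain : {in edges &, forall e f : {set vertex}, e \subset f -> e = f}
}.

Definition uniform (H : hypergraph) (r : nat) : Prop :=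
  {in edges H, forall e : {set H}, #|e| = r}.

Definition proper_coloring (H : hypergraph) (C : choiceType) (theta : H -> C) : bool :=
  [forall e in edges H, 2 <= #|` [fset theta v | v in e]|].

Definition P (H : hypergraph) (k : nat) : nat :=
  #|[set theta : {ffun H -> 'I_k} | proper_coloring theta]|.

Definition assignment (H : hypergraph) := H -> {fset nat}.

Definition k_assignment (H : hypergraph) (k : nat) (L : assignment H) : Prop :=
  forall v, #|` L v| = k.

(* An L-coloring is a dependent function picking a color of L v for each v;
   properness compares the underlying natural numbers. *)
Definition P_list (H : hypergraph) (L : assignment H) : nat :=
  #|[set theta : {dffun forall v : H, L v} | proper_coloring (fun v => val (theta v))]|.

Lemma P_list_exists (H : hypergraph) (k : nat) :
  exists p, `[< exists2 L : assignment H, k_assignment k L & P_list L = p >].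
Proof.
pose L : assignment H := fun=> [fset i in iota 0 k].
exists (P_list L); apply/asboolP; exists L => // v.
by rewrite card_fseq undup_id ?iota_uniq // size_iota.
Qed.

Definition P_l (H : hypergraph) (k : nat) : nat := ex_minn (P_list_exists H k).

(* tau' is given by its graph: that some q works is part of what has to be
   proved. *)
Definition threshold (H : hypergraph) (q : nat) : Prop :=
  0 < q /\ forall k, q <= k -> P_l H k = P H k.

Definition is_tau' (H : hypergraph) (q : nat) : Prop :=
  threshold H q /\ forall q', threshold H q' -> q <= q'.

Definition E_near (H : hypergraph) (r : nat) (e : {set H}) : {set {set H}} :=
  [set e' in edges H | #|e :&: e'| == r - 1].

Definition gamma (H : hypergraph) (r : nat) : nat :=
  \max_(e in edges H) #|E_near r e|.

(* The intersection of the lists over e; finite sets of naturals have no top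
   element, so it is cut out of their union (e is nonempty for an edge). *)
Definition common (H : hypergraph) (L : assignment H) (e : {set H}) :
    {fset nat} :=
  [fset c in \bigcup_(v in e) L v | [forall v in e, c \in L v]].

(* The subtraction is exact for an edge e and a k-assignment L. *)
Definition alpha_edge (H : hypergraph) (k : nat) (L : assignment H)
    (e : {set H}) : nat :=
  k - #|` common L e|.

Definition alpha (H : hypergraph) (k : nat) (L : assignment H) : nat :=
  \sum_(e in edges H) alpha_edge k L e.

(* Main.v *)
From HB Require Import structures.
From Stdlib Require Import NArith.
From mathcomp Require Import all_boot all_order all_algebra finmap boolp.
From mathcomp Require Import perm zify ring lra.
Require Import Defs.
Set Implicit Arguments.
Unset Strict Implicit.
Unset Printing Implicit Defensive.
Import Order.TTheory GRing.Theory Num.Theory.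

(** Write [F L B C] for the number of colorings from the lists [L] making every
edge of [B] monochromatic and no edge of [C] monochromatic, and let [Lam B C]
be the difference between [F] for constant lists of size [k] and [F] for [L].
Adding the edges one at a time, [P_list L - P H k] is the sum of [Lam [e] C]
over the edges [e], where [C] is the family of the edges that precede [e].

For the members of [C] meeting [e], a coloring that is constant on [e] with
color [c] sees only the set of vertices of color [c]; comparing the two sides
set by set bounds [Lam] below by the first order term [alpha e * k ^ (n - r)]
minus one term per pair of meeting edges.  The members of [C] disjoint from
[e] are removed by inclusion-exclusion: a family of [j] edges containing two
disjoint ones costs at most [alpha * k ^ (n - r - j)], since every edge that is
not forced to be monochromatic divides the number of colorings by [k].
Altogether [P_list L - P H k] is at least [k ^ (n - r)] times the sum of
[alpha e * (1 - o / k - g e * (k - 1) / k ^ 2)], where [g e] counts the edges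
meeting [e] in [r - 1] points and
[o = ((1 + 1 / k) ^ (m - 1) - (1 - 1 / k) ^ (m - 1)) / 2].

The threshold claim needs nonnegativity already for [k] the floor of the bound.
There the coefficient is nonnegative except for [m = 5] and [k = 2], or [m = 5],
[k = 3] and [gamma = 3].  For [k = 3], adding the edges by increasing [alpha]
gives an extra gain on triples of pairwise meeting edges.  For [k = 2], a
union bound over the edges with [alpha > 0] reduces the claim to a count of
2-colorings. *)

(** * Counting list colorings with forced monochromatic edges *)

Section Counting.
Variables (V T : finType).
Implicit Types (e f x : {set V}) (B C : seq {set V}) (th : {ffun V -> T}).
Implicit Types (L : V -> {set T}).

Definition lcol L th := [forall v, th v \in L v].

Definition mono th e := [forall u in e, forall v in e, th u == th v].

Definition cnt L B C :=
  #|[set th | [&& lcol L th, all (mono th) B & ~~ has (mono th) C]]|.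

Lemma monoP th e :
  reflect {in e &, forall u v, th u = th v} (mono th e).
Proof.
apply: (iffP forall_inP) => [h u v ue ve|h u ue].
  by apply/eqP; move/forall_inP: (h u ue); apply.
by apply/forall_inP => v ve; apply/eqP/h.
Qed.

Lemma cnt_cons L B x C : cnt L B (x :: C) + cnt L (x :: B) C = cnt L B C.
Proof.
rewrite /cnt -(cardsID [set th | mono th x]
  [set th | [&& lcol L th, all (mono th) B & ~~ has (mono th) C]]) addnC.
congr (_ + _); apply: eq_card => th; rewrite !inE /=;
  by case: (mono th x); rewrite ?andbT ?andbF ?andTb //= ?andbF.
Qed.

(** If [p] sends each vertex to the root of its component, adding [e] redirects every component that
    meets [e] to the root of one picked vertex of [e]. *)
Definition bstep (p : V -> V) e v :=
  if p v \in p @: e then (if [pick u in e] is Some u then p u else p v) else p v.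

(* [bmap B] sends a vertex to the representative of its connected component
   in the hypergraph with edge list [B]. *)
Fixpoint bmap B : V -> V :=
  if B is e :: B' then bstep (bmap B') e else id.

Definition broots B := [set v | bmap B v == v].

Definition bcom L B v := \bigcap_(u | bmap B u == v) L u.

Lemma bmapK B v : bmap B (bmap B v) = bmap B v.
Proof.
elim: B v => //= e B IH v; rewrite /bstep.
case: pickP => [u /= ue|_]; last by rewrite !if_same IH.
case: (boolP (bmap B v \in _)) => h; last by rewrite IH (negPf h).
by rewrite IH imset_f.
Qed.

Lemma bmap_step B e v : bmap (e :: B) (bmap B v) = bmap (e :: B) v.
Proof. by rewrite /= /bstep bmapK. Qed.

Lemma bmap_edge B e u v :
  u \in e -> v \in e -> bmap (e :: B) u = bmap (e :: B) v.
Proof.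
move=> ue ve; rewrite /= /bstep !imset_f //.
by case: pickP => [//|/(_ u) /=]; rewrite ue.
Qed.

(** Monochromatic edges propagate a color along each component, so a coloring satisfying [B] is
    determined by its values at the roots. *)
Lemma bmapP th B :
  reflect (forall v, th (bmap B v) = th v) (all (mono th) B).
Proof.
apply: (iffP idP); elim: B => //= e B IH.
  case/andP=> /monoP me /IH hB v; rewrite /bstep.
  case: ifP => // /imsetP[w we hw].
  by case: pickP => [u ue|/(_ w) /=]; rewrite ?we // hB -(hB v) hw hB; apply: me.
move=> h; have hB v : th (bmap B v) = th v.
  by rewrite -(h (bmap B v)) -/(bmap (e :: B) _) bmap_step h.
rewrite IH // andbT; apply/monoP => u v ue ve.
by rewrite -(h u) -(h v) -/(bmap (e :: B) u) (@bmap_edge B e u v).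
Qed.

Lemma bmap_forced th B x : {in x &, forall u v, bmap B u = bmap B v} ->
  all (mono th) B -> mono th x.
Proof.
move=> hx /bmapP h; apply/monoP => u v ux vx.
by rewrite -(h u) -(h v) (hx u v).
Qed.

Lemma bmap_root B v : bmap B v \in broots B.
Proof. by rewrite inE bmapK. Qed.

Lemma bmap_cons B e u v : u \in e ->
  bmap (e :: B) v = if bmap B v \in bmap B @: e then bmap (e :: B) u else bmap B v.
Proof.
move=> ue; rewrite /= /bstep (imset_f _ ue).
by case: ifP => // _; case: pickP => [//|/(_ u) /=]; rewrite ue.
Qed.

Lemma bmap_in B e u : u \in e -> bmap (e :: B) u \in bmap B @: e.
Proof.
move=> ue; rewrite /= /bstep (imset_f _ ue).
by case: pickP => [w we|/(_ u) /=]; rewrite ?ue //; apply: imset_f.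
Qed.

Lemma broots_cons B e u : u \in e ->
  broots (e :: B) = bmap (e :: B) u |: (broots B :\: (bmap B @: e)).
Proof.
move=> ue; set r := bmap (e :: B) u.
have re : r \in bmap B @: e by apply: bmap_in.
apply/setP => v; rewrite inE (bmap_cons _ _ ue) !inE -/r.
have [hv|hv] := boolP (bmap B v \in bmap B @: e).
  have [->//|nvr] := eqVneq v r.
  apply/esym/negbTE; rewrite negb_and negbK.
  case: (eqVneq (bmap B v) v) => [E|]; last by rewrite orbT.
  by rewrite -E hv.
have nv : v != r.
  apply: contraNneq hv => ->; case/imsetP: re => w we ->.
  by rewrite bmapK imset_f.
rewrite (negPf nv); case: (eqVneq (bmap B v) v) => [E|]; last by rewrite andbF.
by rewrite -{1}E (negPf hv).
Qed.

Lemma card_broots_cons B e : e != set0 ->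
  #|broots (e :: B)| + #|bmap B @: e| = #|broots B| + 1.
Proof.
case/set0Pn=> u ue.
have sub : bmap B @: e \subset broots B.
  by apply/subsetP => _ /imsetP[w _ ->]; apply: bmap_root.
rewrite (broots_cons _ ue) cardsU1 !inE (bmap_in _ ue) /= cardsD (setIidPr sub).
by have := subset_leq_card sub; lia.
Qed.

Lemma card_lcol L : #|[set th | lcol L th]| = \prod_v #|L v|.
Proof.
have -> : #|[set th | lcol L th]| = #|(family (fun v => mem (L v)) : simpl_pred {ffun V -> T})|.
  by apply: eq_card => th; rewrite inE; apply/forallP/familyP => h v; have := h v.
rewrite card_family foldrE big_map big_enum /=.
by apply: eq_bigr => v _; apply: eq_card => c.
Qed.

(** A coloring satisfying [B] chooses one color per component, and that color has to lie in every
    list of the component. *)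
Lemma cnt_blocks L B : cnt L B [::] = \prod_(v in broots B) #|bcom L B v|.
Proof.
case: (pickP (fun _ : T => true)) => [t0 _|noT]; last first.
  case: (pickP (fun _ : V => true)) => [v0 _|noV].
    have -> : cnt L B [::] = 0.
      apply/eqP; rewrite cards_eq0; apply/eqP/setP => th.
      by have := noT (th v0).
    rewrite (bigD1 (bmap B v0)) ?bmap_root //= (_ : #|bcom L B _| = 0) //.
    by apply: eq_card0 => t; have := noT t.
  rewrite big1 => [|v _]; last by have := noV v.
  have <- : #|[set th | lcol L th]| = 1.
    by rewrite card_lcol big1 // => v _; have := noV v.
  apply: eq_card => th; rewrite !inE andbT /=.
  suff -> : all (mono th) B by rewrite andbT.
  by apply/bmapP => v; have := noV v.
(* Non-roots get the dummy list [[set t0]], so that [card_lcol] counts the choices at the roots.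
   This needs some color [t0], hence the separate treatment of an empty [T]. *)
pose L' v := if v \in broots B then bcom L B v else [set t0].
have <- : \prod_v #|L' v| = \prod_(v in broots B) #|bcom L B v|.
  rewrite (bigID (mem (broots B))) /= [X in _ * X]big1 ?muln1.
    by apply: eq_bigr => v hv; rewrite /L' hv.
  by move=> v hv; rewrite /L' (negPf hv) cards1.
rewrite -card_lcol.
pose g (th : {ffun V -> T}) : {ffun V -> T} := [ffun v => th (bmap B v)].
have ginj : {in [set th | lcol L' th] &, injective g}.
  move=> t1 t2; rewrite !inE => /forallP h1 /forallP h2 E; apply/ffunP => v.
  have [hv|hv] := boolP (v \in broots B).
    move/ffunP: E => /(_ v); rewrite !ffunE.
    by move: hv; rewrite inE => /eqP ->.
  by have := h1 v; have := h2 v; rewrite /L' (negPf hv) !inE => /eqP -> /eqP ->.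
rewrite -(card_in_imset ginj); apply: eq_card => th; rewrite !inE /= andbT.
apply/andP/imsetP => [[/forallP hL /bmapP hB]|[ps]].
  exists [ffun v => if v \in broots B then th v else t0].
    rewrite inE; apply/forallP => v; rewrite ffunE /L'.
    case: ifP => hv; last by rewrite inE.
    by apply/bigcapP => u /eqP <-; rewrite hB.
  by apply/ffunP => v; rewrite !ffunE bmap_root hB.
rewrite inE => /forallP hp ->; split; last first.
  by apply/bmapP => v; rewrite !ffunE bmapK.
apply/forallP => v; rewrite ffunE.
have := hp (bmap B v); rewrite /L' bmap_root => /bigcapP; exact.
Qed.

Definition com L e := [set c | [forall v in e, c \in L v]].

Lemma comP L e c : reflect {in e, forall v, c \in L v} (c \in com L e).
Proof. by rewrite inE; apply: (iffP forall_inP). Qed.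

End Counting.

(** * Deficits of the components and bounds on the counts *)

Lemma leq_card_bigcup (I U : finType) (A : {set I}) (F : I -> {set U}) :
  #|\bigcup_(i in A) F i| <= \sum_(i in A) #|F i|.
Proof.
apply: (big_ind2 (fun (X : {set U}) n => #|X| <= n)); rewrite ?cards0 //.
move=> X1 n1 X2 n2 h1 h2; apply: leq_trans (leq_add h1 h2).
exact: leq_card_setU.
Qed.

(** This is the Weierstrass inequality [prod (1 - d i / k) >= 1 - sum (d i / k)], multiplied by
    [k ^ (size r).+1] and written without subtraction. *)
Lemma prod_deficit (I : Type) (r : seq I) (k : nat) (a d : I -> nat) :
  (forall i, a i <= k) -> (forall i, k <= a i + d i) ->
  k * k ^ size r <= k * \prod_(i <- r) a i + k ^ size r * \sum_(i <- r) d i.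
Proof.
move=> ak kd; elim: r => [|i r IH]; first by rewrite !big_nil muln0 addn0.
rewrite !big_cons /= expnS.
move: IH (ak i) (kd i).
set s := k ^ size r; set p := \prod_(_ <- _) _; set q := \sum_(_ <- _) _.
move=> IH h1 h2.
have : k * s * k <= k * s * (a i + d i) by rewrite leq_mul2l h2 orbT.
have : a i * (k * s) <= a i * (k * p + s * q) by rewrite leq_mul2l IH orbT.
have : a i * (s * q) <= k * (s * q) by rewrite leq_mul2r h1 orbT.
nia.
Qed.

Section Lists.
Variables (V T : finType) (k : nat) (L : V -> {set T}).
Hypothesis hL : forall v, #|L v| = k.
Implicit Types (e f x : {set V}) (B C : seq {set V}) (th : {ffun V -> T}).

Definition al e := k - #|com L e|.

Lemma com_sub e v : v \in e -> com L e \subset L v.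
Proof. by move=> ve; apply/subsetP => c /comP; apply. Qed.

Lemma card_com e : e != set0 -> #|com L e| <= k.
Proof.
by case/set0Pn=> v /com_sub/subset_leq_card; rewrite hL.
Qed.

Lemma al_com e : e != set0 -> al e + #|com L e| = k.
Proof. by move/card_com; rewrite /al; lia. Qed.

Lemma bcom_sub B v u : bmap B u = v -> bcom L B v \subset L u.
Proof. by move=> uv; apply: bigcap_inf; rewrite uv. Qed.

Lemma card_bcom B v : v \in broots B -> #|bcom L B v| <= k.
Proof.
by rewrite inE => /eqP/bcom_sub/subset_leq_card; rewrite hL.
Qed.

Lemma block_deficit B : set0 \notin B ->
  exists2 d : V -> nat,
    forall v, v \in broots B -> k <= #|bcom L B v| + d v
  & \sum_(v in broots B) d v <= \sum_(e <- B) al e.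
Proof.
elim: B => [_|e B IH].
  exists (fun=> 0) => [v _|]; last by rewrite big_nil big1.
  rewrite addn0 -(hL v); apply: subset_leq_card.
  by apply/bigcapsP => u /eqP <-.
rewrite inE negb_or eq_sym => /andP[ne0 /IH[d hd sd]].
case/set0Pn: (ne0) => u0 u0e; set r := bmap (e :: B) u0.
have re : r \in bmap B @: e by apply: bmap_in.
(* The merged component is charged [al e] plus the charges of the components it absorbs; the other
   roots keep theirs, so the total grows by [al e] at most. *)
exists (fun v => if v == r then al e + \sum_(w in bmap B @: e) d w else d v).
  move=> v; rewrite (broots_cons _ u0e) !inE -/r.
  case: eqVneq => [-> _|nvr /= /andP[vne vr]]; last first.
    apply: leq_trans (hd v _) _; first by rewrite inE.
    rewrite leq_add2r subset_leq_card //; apply/subsetP => c /bigcapP hc.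
    apply/bigcapP => u /eqP; rewrite (bmap_cons _ _ u0e).
    by case: ifP => [_ E|_ E]; [rewrite -E eqxx in nvr | apply: hc; apply/eqP].
  rewrite -(hL u0).
  (* A color of [com L e] missing from the merged component is missing from some absorbed component
     [w], although it lies in the list of a vertex [y] of [e] in [w]; [X w] collects such colors. *)
  pose X w := if [pick y in e | bmap B y == w] is Some y
              then L y :\: bcom L B w else set0.
  have : L u0 \subset bcom L (e :: B) r :|: ((L u0 :\: com L e)
            :|: \bigcup_(w in bmap B @: e) X w).
    apply/subsetP => c cu; rewrite !inE cu andbT.
    have [ce|] := boolP (c \in com L e); last by rewrite inE => ->; rewrite orbT.
    have [//|/bigcapP nc] := boolP (c \in bcom L (e :: B) r).
    have ce' := ce; rewrite inE in ce'; rewrite ce' /=.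
    have [[w we hw]|nw] := pselect (exists2 w, w \in bmap B @: e & c \notin bcom L B w).
      apply/bigcupP; exists w => //; rewrite /X.
      case: pickP => [y /= /andP[ye _]|].
        by rewrite inE hw /=; move/comP: ce; apply.
      case/imsetP: we => y ye -> /(_ y) /=; by rewrite ye eqxx.
    case: nc => u /eqP Eu.
    have hu : bmap B u \in bmap B @: e.
      move: Eu; rewrite (bmap_cons _ _ u0e); case: (boolP (bmap B u \in _)) => // nh E.
      by rewrite E re in nh.
    apply: contra_notT nw => ncu; exists (bmap B u) => //.
    by apply: contra ncu => /bigcapP; apply.
  move/subset_leq_card/leq_trans; apply.
  apply: leq_trans (leq_card_setU _ _) _; rewrite leq_add2l.
  apply: leq_trans (leq_card_setU _ _) _; apply: leq_add.
    rewrite cardsD hL /al; suff -> : L u0 :&: com L e = com L e by [].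
    by apply/setIidPr/com_sub.
  apply: leq_trans (leq_card_bigcup _ _) _; apply: leq_sum => w /imsetP[y ye wy].
  have hw : w \in broots B by rewrite wy bmap_root.
  rewrite /X; case: pickP => [z /= /andP[ze /eqP zw]|_]; last by rewrite cards0.
  rewrite cardsD (setIidPr (bcom_sub zw)) hL.
  by have := hd _ hw; lia.
rewrite (broots_cons _ u0e) big_cons big_setU1 /=; last by rewrite !inE re.
rewrite eqxx -addnA leq_add2l; apply: leq_trans sd.
have sub : bmap B @: e \subset broots B.
  by apply/subsetP => _ /imsetP[w _ ->]; apply: bmap_root.
rewrite [X in _ <= X](big_setID (bmap B @: e)) /= (setIidPr sub) leq_add2l.
apply: leq_sum => v hv; rewrite ifN //.
by apply: contraTneq hv => ->; rewrite !inE re.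
Qed.

Lemma cnt_le B : cnt L B [::] <= k ^ #|broots B|.
Proof.
rewrite cnt_blocks -prod_nat_const; apply: leq_prod => v.
exact: card_bcom.
Qed.

Lemma cnt_ge B : set0 \notin B ->
  k * k ^ #|broots B| <= k * cnt L B [::] + k ^ #|broots B| * \sum_(e <- B) al e.
Proof.
case/block_deficit=> d hd sd.
pose a v := if v \in broots B then #|bcom L B v| else k.
pose d' v := if v \in broots B then d v else 0.
have := @prod_deficit _ (enum (broots B)) k a d'.
rewrite -cardE !big_enum /= => h; rewrite cnt_blocks.
have -> : \prod_(v in broots B) #|bcom L B v| = \prod_(v in broots B) a v.
  by apply: eq_bigr => v hv; rewrite /a hv.
apply: leq_trans (h _ _) _.
- by move=> v; rewrite /a; case: ifP => // /card_bcom.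
- by move=> v; rewrite /a /d'; case: ifP => [/hd|]; rewrite ?addn0.
rewrite leq_add2l leq_mul2l (leq_trans _ sd) ?orbT //.
by apply: leq_sum => v hv; rewrite /d' hv.
Qed.

End Lists.

Lemma cnt_const (V T : finType) (S0 : {set T}) (B : seq {set V}) :
  cnt (fun=> S0) B [::] = #|S0| ^ #|broots B|.
Proof.
rewrite cnt_blocks -prod_nat_const; apply: eq_bigr => v hv.
suff -> : bcom (fun=> S0) B v = S0 by [].
apply/setP => c; apply/bigcapP/idP => [h|hc u _ //].
by apply: (h v); move: hv; rewrite inE.
Qed.

(** * Inclusion-exclusion for the difference between constant and given lists *)

Local Open Scope ring_scope.

Section Expansion.
Variables (V T : finType) (k : nat) (L : V -> {set T}) (S0 : {set T}).
Hypothesis hL : forall v, #|L v| = k.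
Hypothesis hS0 : #|S0| = k.
Hypothesis k_gt0 : (0 < k)%N.
Implicit Types (e f x : {set V}) (B C : seq {set V}).

Notation kR := (k%:R : rat).
Notation alR e := ((al k L e)%:R : rat).
Notation alS B := (\sum_(e <- B) alR e).

Definition F0 B : rat := (cnt (fun=> S0) B [::])%:R.

Definition Lam B C : rat := (cnt (fun=> S0) B C)%:R - (cnt L B C)%:R.

Lemma kR_gt0 : 0 < kR.
Proof. by rewrite ltr0n. Qed.

Lemma F0_ge0 B : 0 <= F0 B.
Proof. exact: ler0n. Qed.

Lemma F0E B : F0 B = kR ^+ #|broots B|.
Proof. by rewrite /F0 cnt_const hS0 natrX. Qed.

Lemma Lam_cons B x C : Lam B (x :: C) = Lam B C - Lam (x :: B) C.
Proof.
rewrite /Lam -(cnt_cons (fun=> S0) B x C) -(cnt_cons L B x C) !natrD.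
by ring.
Qed.

Lemma Lam_nil_ge0 B : 0 <= Lam B [::].
Proof. by rewrite /Lam subr_ge0 ler_nat cnt_const hS0 cnt_le. Qed.

Lemma Lam_nil_le B : set0 \notin B -> Lam B [::] <= F0 B / kR * alS B.
Proof.
move=> hB; have := cnt_ge hL hB; rewrite -(ler_nat rat) natrD !natrM natrX.
rewrite natr_sum -F0E /Lam -/(F0 B) => h.
rewrite mulrAC ler_pdivlMr ?kR_gt0 // mulrBl.
by rewrite lerBlDl ![_ * kR]mulrC addrC; move: h; rewrite addrC.
Qed.

Lemma forced_card B x : (#|bmap B @: x| <= 1)%N ->
  {in x &, forall u v, bmap B u = bmap B v}.
Proof. by move/card_le1_eqP=> h u v ux vx; apply: h; apply: imset_f. Qed.

Lemma cnt_forced (L' : V -> {set T}) B x C : (#|bmap B @: x| <= 1)%N -> cnt L' B (x :: C) = 0%N.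
Proof.
move=> /forced_card h; apply/eqP; rewrite cards_eq0 -subset0.
apply/subsetP => th; rewrite !inE /= negb_or => /and3P[_ hB /andP[nx _]].
by rewrite (bmap_forced h hB) in nx.
Qed.

Lemma F0_cons B x : x != set0 -> F0 (x :: B) * kR ^+ #|bmap B @: x|.-1 = F0 B.
Proof.
move=> hx; rewrite !F0E -exprD; congr (_ ^+ _).
have := card_broots_cons B hx.
have : (0 < #|bmap B @: x|)%N by rewrite card_gt0 imset_eq0.
lia.
Qed.

Lemma F0_cons_le B x : x != set0 -> (1 < #|bmap B @: x|)%N ->
  F0 (x :: B) <= F0 B / kR.
Proof.
move=> hx h; rewrite -(F0_cons B hx) ler_pdivlMr ?kR_gt0 //.
rewrite ler_wpM2l ?F0_ge0 // -natrX ler_nat -{1}(expn1 k).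
by rewrite leq_pexp2l //; lia.
Qed.

(* [PO false a C] (resp. [PO true a C]) is the sum, over the subfamilies [A]
   of [C] of even (resp. odd) size, of [k ^- #|A| * (a + alS A)]. *)
Fixpoint PO (b : bool) (a : rat) C : rat :=
  if C is x :: C' then PO b a C' + kR^-1 * PO (~~ b) (a + alR x) C'
  else if b then 0 else a.

Lemma PO_ge0 b a C : 0 <= a -> 0 <= PO b a C.
Proof.
elim: C b a => [|x C IH] b a ha /=; first by case: b.
by rewrite addr_ge0 ?IH // mulr_ge0 ?invr_ge0 ?ler0n // IH // addr_ge0 ?ler0n.
Qed.

(** Both bounds are proved together: by [Lam_cons] the new edge enters [B] with a minus sign, which
    exchanges the two parities, and it costs a factor [k]. *)
Lemma Lam_bounds B C : set0 \notin B -> set0 \notin C ->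
  (Lam B C <= F0 B / kR * PO false (alS B) C) &&
  (- Lam B C <= F0 B / kR * PO true (alS B) C).
Proof.
elim: C B => [|x C IH] B hB.
  by move=> _; rewrite Lam_nil_le // mulr0 oppr_le0 Lam_nil_ge0.
rewrite inE negb_or eq_sym => /andP[hx hC].
have al0 D : 0 <= alS D by apply: sumr_ge0.
(* An edge inside one component of [B] saves no factor [k], but it is forced to be monochromatic, so
   both counts vanish. *)
have [hf|hf] := leqP #|bmap B @: x| 1.
  rewrite {1 2}/Lam !cnt_forced // subrr oppr0.
  by rewrite !mulr_ge0 ?invr_ge0 ?F0_ge0 ?PO_ge0 ?ler0n.
have hxB : set0 \notin x :: B by rewrite inE negb_or eq_sym hx.
have /andP[u1 l1] := IH B hB hC; have /andP[u2 l2] := IH _ hxB hC.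
have step b : F0 (x :: B) / kR * PO b (alS (x :: B)) C
    <= F0 B / kR * (kR^-1 * PO b (alS B + alR x) C).
  rewrite big_cons (addrC (alR x)) mulrA ler_wpM2r ?PO_ge0 ?addr_ge0 //.
  by rewrite ler_wpM2r ?invr_ge0 ?ler0n ?F0_cons_le.
rewrite Lam_cons /= !mulrDr.
have := step false; have := step true => s1 s2; apply/andP; split; lra.
Qed.

End Expansion.

(** * Discarding the edges disjoint from a given edge *)

Lemma card_bmap1 (V : finType) (e h : {set V}) :
  #|bmap [:: e] @: h| = (#|h :\: e| + (h :&: e != set0%SET))%N.
Proof.
have out v : v \notin e -> bmap [:: e] v = v.
  by move=> ve; rewrite /= /bstep imset_id (negPf ve).
have <- : #|bmap [:: e] @: (h :\: e)| = #|h :\: e|.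
  apply: card_in_imset => u v; rewrite !inE => /andP[ue _] /andP[ve _].
  by rewrite !out.
rewrite -{1}(setID h e) imsetU setUC cardsU.
have in_e v : v \in e -> bmap [:: e] v \in e.
  by move=> ve; have := bmap_in [::] ve; rewrite imset_id.
rewrite (_ : (_ @: _) :&: _ = set0) ?cards0 ?subn0; last first.
  apply/setP => v; rewrite in_setI in_set0; apply/negbTE/negP.
  case/andP=> /imsetP[a]; rewrite inE => /andP[ae _] -> /imsetP[b].
  by rewrite inE => /andP[_ be]; rewrite (out _ ae) => E; rewrite E in_e in ae.
congr (_ + _)%N; case: eqVneq => [->|/set0Pn[u]]; first by rewrite imset0 cards0.
rewrite inE => /andP[uh ue]; apply/eqP; rewrite eqn_leq card_gt0 imset_eq0.
apply/andP; split; last by apply/set0Pn; exists u; rewrite inE uh.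
apply/card_le1_eqP => a b /imsetP[x]; rewrite inE => /andP[_ xe] ->.
case/imsetP=> y; rewrite inE => /andP[_ ye] ->.
exact: (@bmap_edge _ [::] e).
Qed.

Section Bound.
Variables (V T : finType) (k : nat) (L : V -> {set T}) (S0 : {set T}).
Hypothesis hL : forall v, #|L v| = k.
Hypothesis hS0 : #|S0| = k.
Hypothesis k_gt0 : (0 < k)%N.
Implicit Types (e f g h x : {set V}) (B C I J : seq {set V}) (psi : {ffun V -> T}).

Notation kR := (k%:R : rat).
Notation alR e := ((al k L e)%:R : rat).
Notation alS B := (\sum_(e <- B) alR e).
Notation Lam := (Lam L S0).
Notation F0 := (F0 (V:=V) S0).
Notation PO := (PO k L).

Let kR_gt0 : 0 < kR. Proof. exact: kR_gt0. Qed.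
Let kV_ge0 : 0 <= kR^-1. Proof. by rewrite invr_ge0 ltW. Qed.

Lemma F0_edge e : e != set0 -> F0 [:: e] * kR^-1 = kR ^+ (#|V| - #|e|).
Proof.
move=> e0; rewrite (F0E hS0).
have := card_broots_cons [::] e0; rewrite imset_id.
have -> : broots [::] = [set: V] by apply/setP => v; rewrite !inE eqxx.
rewrite cardsT => h; have le : (#|e| <= #|V|)%N by apply: max_card.
rewrite (_ : #|broots [:: e]| = (#|V| - #|e|).+1)%N; last by move: h le; lia.
by rewrite exprSr mulfK // gt_eqF.
Qed.

Lemma F0_pair_le e h : e != set0 -> h != set0 -> (2 < #|bmap [:: e] @: h|)%N ->
  F0 [:: h; e] <= F0 [:: e] * kR^-1 * kR^-1.
Proof.
move=> e0 h0 c; rewrite -(F0_cons hS0 k_gt0 [:: e] h0).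
rewrite -mulrA -invfM ler_pdivlMr ?mulr_gt0 // ler_wpM2l ?F0_ge0 //.
rewrite -expr2 -!natrX ler_nat leq_pexp2l //; lia.
Qed.

(** The members of [J] are removed one at a time. Since [h] is disjoint from [e], it meets more than
    two components of [[:: e]], which saves a factor [k ^ 2]; the costs add up through the recursion
    of [PO]. *)
Lemma Lam_split e J I : (2 < #|e|)%N -> set0 \notin I ->
  {in J, forall h : {set V}, (2 < #|h|)%N && [disjoint h & e]} ->
  Lam [:: e] I - F0 [:: e] * kR^-1 * kR^-1 *
      (PO true (alR e) (J ++ I) - PO true (alR e) I) <= Lam [:: e] (J ++ I).
Proof.
move=> ce I0; elim: J => [_|h J IH hJ] /=; first by rewrite subrr mulr0 subr0.
have e0 : e != set0 by rewrite -card_gt0; lia.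
have {}IH := IH (fun x xJ => hJ x (mem_behead (s := h :: J) xJ)).
have /andP[ch dh] := hJ h (mem_head _ _).
have h0 : h != set0 by rewrite -card_gt0; lia.
have JI0 : set0 \notin J ++ I.
  rewrite mem_cat negb_or I0 andbT; apply/negP => /(mem_behead (s := h :: J))/hJ.
  by rewrite cards0.
have hB : set0 \notin [:: h; e] by rewrite !inE !(eq_sym set0) negb_or h0 e0.
have /andP[ub _] := Lam_bounds hL hS0 k_gt0 hB JI0.
have fle : F0 [:: h; e] <= F0 [:: e] * kR^-1 * kR^-1.
  apply: F0_pair_le => //; rewrite card_bmap1.
  by rewrite (setDidPl dh) (leq_trans ch) // leq_addr.
rewrite Lam_cons.
have : F0 [:: h; e] / kR * PO false (alS [:: h; e]) (J ++ I)
   <= F0 [:: e] * kR^-1 * kR^-1 * (kR^-1 * PO false (alR e + alR h) (J ++ I)).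
  rewrite !big_cons big_nil addr0 (addrC (alR h)) mulrA ler_wpM2r //.
    by rewrite PO_ge0 // addr_ge0.
  by rewrite ler_wpM2r.
move=> st; move: IH; lra.
Qed.

(** The even ([false]) or odd ([true]) part of [(1 + 1 / k) ^ s]: the sum of [k ^- #|A|] over the
    subsets [A] of that parity of an [s]-set. *)
Definition pp (b : bool) (s : nat) : rat :=
  ((1 + kR^-1) ^+ s + (if b then -1 else 1) * (1 - kR^-1) ^+ s) / 2.

Lemma ppS b s : pp b s.+1 = pp b s + kR^-1 * pp (~~ b) s.
Proof. by rewrite /pp !exprS; move: (kR^-1) => u; case: b => /=; field. Qed.

(** The constant [a] occurs for every subfamily of the right parity, and [alR x] for those
    containing [x], whose other members form a subfamily of the opposite parity of one edge fewer.
    For empty [C] the predecessor is multiplied by an empty sum. *)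
Lemma PO_closed b a C :
  PO b a C = a * pp b (size C) + alS C * (kR^-1 * pp (~~ b) (size C).-1).
Proof.
elim: C b a => [|x C IH] b a.
  by rewrite big_nil mul0r addr0 /pp !expr0; case: b => /=; field.
rewrite /= !IH big_cons ppS negbK; case: C {IH} => [|y C].
  by rewrite big_nil /=; ring.
by rewrite /= -/(size (y :: C)) [pp (~~ b) (size C).+1]ppS negbK; ring.
Qed.

Lemma PO_even_ge a C : 0 <= a -> a <= PO false a C.
Proof.
elim: C => //= x C IH a0; apply: le_trans (IH a0) _.
by rewrite lerDl mulr_ge0 // PO_ge0 // addr_ge0.
Qed.

Lemma PO_odd_ge a C : 0 <= a -> kR^-1 * \sum_(f <- C) (a + alR f) <= PO true a C.
Proof.
move=> a0; elim: C => [|x C IH] /=; first by rewrite big_nil mulr0.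
rewrite big_cons mulrDr addrC lerD // ler_wpM2l //.
by apply: PO_even_ge; rewrite addr_ge0.
Qed.

End Bound.

(** * Relabelling the lists to a common palette, and counting color by color *)

Lemma set_relabel (T : finType) (S S0 : {set T}) (c c0 : T) :
  #|S| = #|S0| -> c0 \in S0 ->
  exists phi : T -> T, [/\ {in S &, injective phi}, {in S, forall x, phi x \in S0}
    & c \in S -> phi c = c0].
Proof.
move=> cS hc0; pose h x := nth c0 (enum S0) (index x (enum S)).
have hlt x : x \in S -> (index x (enum S) < size (enum S0))%N.
  by move=> xS; rewrite -cardE -cS cardE index_mem mem_enum.
have hin x : x \in S -> h x \in S0 by move=> /hlt; rewrite -mem_enum; apply: mem_nth.
have hinj : {in S &, injective h}.
  move=> x y xS yS /eqP; rewrite nth_uniq ?enum_uniq ?hlt // => /eqP E.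
  by rewrite -(nth_index c0 (s := enum S) (x := x)) ?mem_enum // E nth_index ?mem_enum.
have [cin|cout] := boolP (c \in S); last by exists h; split=> // cin; rewrite cin in cout.
(* The bijection between the two enumerations is followed by the transposition that brings the image
   of [c] to [c0]. *)
exists (fun x => tperm (h c) c0 (h x)); split.
- by move=> x y xS yS /perm_inj; apply: hinj.
- by move=> x xS; case: tpermP => [_|_|_ _]; rewrite ?hin.
- by move=> _; rewrite tpermL.
Qed.

Section Transport.
Variables (V T : finType) (k : nat) (L : V -> {set T}) (S0 : {set T}).
Hypothesis hL : forall v, #|L v| = k.
Hypothesis hS0 : #|S0| = k.
Implicit Types (e f g h x : {set V}) (B C I J : seq {set V}).
Implicit Types (th psi : {ffun V -> T}).

Definition allc (c : T) th e := [forall v in e, th v == c].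

Lemma allcP c th e : reflect {in e, forall v, th v = c} (allc c th e).
Proof.
by apply: (iffP forall_inP) => h v ve; [apply/eqP/h | apply/eqP/h].
Qed.

(** The relabelling is indexed by the list and not by the vertex, so that vertices with equal lists
    are relabelled alike; edges of zero deficit rely on this later. *)
Lemma list_relabel (c c0 : T) : c0 \in S0 ->
  exists phi : {set T} -> T -> T, forall v,
  [/\ {in L v &, injective (phi (L v))}, {in L v, forall t, phi (L v) t \in S0}
    & c \in L v -> phi (L v) c = c0].
Proof.
move=> hc0.
have /choice[phi hphi] : forall S : {set T}, exists phi : T -> T, #|S| = k ->
    [/\ {in S &, injective phi}, {in S, forall t, phi t \in S0} & c \in S -> phi c = c0].
  move=> S; have [cS|nS] := pselect (#|S| = k); last by exists id.
  by have [phi h] := @set_relabel T S S0 c c0 (etrans cS (esym hS0)) hc0; exists phi.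
by exists phi => v; apply: hphi.
Qed.

Lemma card_relabel (phi : {set T} -> T -> T) (Q Q' : pred {ffun V -> T}) :
  (forall v, {in L v &, injective (phi (L v))} /\
             {in L v, forall t, phi (L v) t \in S0}) ->
  (forall th, lcol L th -> Q th = Q' [ffun v => phi (L v) (th v)]) ->
  #|[set th | lcol L th && Q th]| = #|[set psi | lcol (fun=> S0) psi && Q' psi]|.
Proof.
move=> hphi hQ; pose g th : {ffun V -> T} := [ffun v => phi (L v) (th v)].
have ginj : {in [set th | lcol L th] &, injective g}.
  move=> t1 t2; rewrite !inE => /forallP h1 /forallP h2 E; apply/ffunP => v.
  move/ffunP: E => /(_ v); rewrite !ffunE; apply: (hphi v).1; [exact: h1|exact: h2].
have gim : g @: [set th | lcol L th] = [set psi | lcol (fun=> S0) psi].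
  apply/eqP; rewrite eqEcard card_in_imset // !card_lcol.
  apply/andP; split; last by apply: leq_prod => v _; rewrite hL hS0.
  apply/subsetP => psi /imsetP[th]; rewrite !inE => /forallP hth ->.
  by apply/forallP => v; rewrite ffunE; apply: (hphi v).2.
rewrite -(card_in_imset (f := g)); last first.
  by move=> t1 t2; rewrite !inE => /andP[h1 _] /andP[h2 _]; apply: ginj; rewrite inE.
apply: eq_card => psi; rewrite !inE; apply/imsetP/andP.
  case=> th; rewrite inE => /andP[hth Qth] ->; split; last by rewrite /g -hQ.
  have : g th \in [set psi | lcol (fun=> S0) psi] by rewrite -gim imset_f ?inE.
  by rewrite inE.
case=> hpsi Qpsi.
have : psi \in g @: [set th | lcol L th] by rewrite gim inE.
case/imsetP=> th; rewrite inE => hth E; exists th => //.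
by rewrite inE hth hQ // -/(g th) -E.
Qed.

Lemma cnt_by_color e I : e != set0 ->
  cnt L [:: e] I = (\sum_(c in com L e)
    #|[set th | lcol L th && (allc c th e && ~~ has (mono th) I)]|)%N.
Proof.
case/set0Pn=> u0 u0e; rewrite /cnt -sum1dep_card.
rewrite (partition_big (fun th : {ffun V -> T} => th u0) (mem (com L e))) /=.
  apply: eq_bigr => c _; rewrite -sum1dep_card; apply: eq_bigl => th.
  rewrite andbT; case: (lcol L th) => //=.
  apply/andP/andP => [[/andP[/monoP m ->] /eqP E]|[/allcP m ->]].
    by split=> //; apply/allcP => v ve; rewrite -E; apply: m.
  by split; [rewrite andbT; apply/monoP => u v ue ve; rewrite !m | rewrite m].
move=> th /and3P[/forallP hth]; rewrite andbT => /monoP m _.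
by apply/comP => v ve; rewrite (m u0 v).
Qed.

(** For each color [c] of [e] the lists are relabelled so that [c] becomes [c0]. An edge meeting [e]
    can only be monochromatic in color [c], so only the vertices of color [c0] matter; exchanging
    the sums leaves a count of colors [c] for each [psi]. *)
Lemma cnt_star e I c0 : c0 \in S0 -> e != set0 ->
  {in I, forall f : {set V}, f :&: e != set0} ->
  cnt L [:: e] I = (\sum_(psi | lcol (fun=> S0) psi && allc c0 psi e)
    #|[set c in com L e | ~~ has (fun f => (c \in com L f) && allc c0 psi f) I]|)%N.
Proof.
move=> hc0 /set0Pn[u0 u0e] hI.
rewrite cnt_by_color; last by apply/set0Pn; exists u0.
rewrite [RHS](eq_bigr (fun psi => \sum_(c in com L e |
    ~~ has (fun f => (c \in com L f) && allc c0 psi f) I) 1)%N); last first.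
  by move=> psi _; rewrite sum1dep_card; apply: eq_card => c; rewrite !inE.
rewrite (exchange_big_dep (mem (com L e))) /=; last by move=> psi c _ /andP[].
apply: eq_bigr => c ce; have [phi hphi] := list_relabel c hc0.
rewrite (@card_relabel phi _ (fun psi => allc c0 psi e &&
   ~~ has (fun f => (c \in com L f) && allc c0 psi f) I)).
- rewrite -sum1dep_card; apply: eq_bigl => psi.
  by rewrite ce andTb andbA.
- by move=> v; case: (hphi v).
move=> th /forallP hth.
have key v : c \in L v -> (th v == c) = (phi (L v) (th v) == c0).
  move=> cv; have [inj _ /(_ cv) <-] := hphi v.
  by apply/eqP/eqP => [->//|]; apply: inj.
have keys f : c \in com L f ->
    allc c th f = allc c0 [ffun v => phi (L v) (th v)] f.
  move=> /comP cf; apply: eq_forallb_in => v vf.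
  by rewrite ffunE key ?cf.
rewrite -keys //; case: (boolP (allc c th e)) => //= /allcP hte; congr (~~ _).
apply: eq_in_has => f fI.
have /set0Pn[u] := hI f fI; rewrite inE => /andP[uf ue].
have [cf|ncf] := boolP (c \in com L f).
  rewrite -keys //=; apply/monoP/allcP => [m v vf|m v w vf wf]; last by rewrite !m.
  by rewrite (m v u) // hte.
(* If some list of [f] misses [c], then [f] cannot be monochromatic, as it shares with [e] a vertex
   of color [c]. *)
apply/negbTE; apply: contra ncf => /monoP m; apply/comP => v vf.
by rewrite -(hte u ue) (m u v).
Qed.

End Transport.

(** * The gain of a single coloring when all forbidden edges meet [e] *)

Lemma card_allc (V T : finType) (S0 : {set T}) (c0 : T) (U : {set V}) :
  c0 \in S0 ->
  #|[set psi : {ffun V -> T} | lcol (fun=> S0) psi && allc c0 psi U]|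
    = (#|S0| ^ (#|V| - #|U|))%N.
Proof.
move=> hc0; pose L' v := if v \in U then [set c0] else S0.
have -> : #|[set psi : {ffun V -> T} | lcol (fun=> S0) psi && allc c0 psi U]|
    = #|[set psi | lcol L' psi]|.
  apply: eq_card => psi; rewrite !inE; apply/andP/forallP.
    case=> /forallP h /allcP hU v; rewrite /L'; case: ifP => // /hU ->.
    by rewrite inE.
  move=> h; split; last first.
    by apply/allcP => v vU; have := h v; rewrite /L' vU inE => /eqP.
  apply/forallP => v; have := h v; rewrite /L'; case: ifP => // _.
  by rewrite inE => /eqP ->.
rewrite card_lcol (bigID (mem U)) /= big1 ?mul1n => [|v vU]; last first.
  by rewrite /L' vU cards1.
rewrite (eq_bigr (fun=> #|S0|)) => [|v vU]; last by rewrite /L' (negPf vU).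
rewrite prod_nat_const; congr (_ ^ _)%N.
by rewrite -(cardC (mem U)) addKn; apply: eq_card => v; rewrite !inE.
Qed.

Lemma seq_argmin (I : eqType) (F : I -> nat) (s : seq I) : s != [::] ->
  exists2 m, m \in s & {in s, forall x, (F m <= F x)%N}.
Proof.
elim: s => // x s IH _; have [->|/IH[m ms hm]] := eqVneq s [::].
  by exists x; rewrite ?mem_head // => y; rewrite inE => /eqP ->.
have [le|lt] := leqP (F x) (F m).
  exists x; rewrite ?mem_head // => y; rewrite inE => /orP[/eqP -> //|/hm].
  exact: leq_trans.
exists m; first by rewrite inE ms orbT.
by move=> y; rewrite inE => /orP[/eqP ->|/hm //]; apply: ltnW.
Qed.

Section Star.
Variables (V T : finType) (k : nat) (L : V -> {set T}) (S0 : {set T}).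
Hypothesis hL : forall v, #|L v| = k.
Hypothesis hS0 : #|S0| = k.
Hypothesis k_gt0 : (0 < k)%N.
Variable c0 : T.
Hypothesis hc0 : c0 \in S0.
Implicit Types (e f g h x : {set V}) (B C I J s : seq {set V}).
Implicit Types (th psi : {ffun V -> T}).

Notation kR := (k%:R : rat).
Notation alR e := ((al k L e)%:R : rat).
Notation alS B := (\sum_(e <- B) alR e).
Notation Lam := (Lam L S0).
Notation F0 := (F0 (V:=V) S0).
Notation PO := (PO k L).
Notation lcol0 := (lcol (V:=V) (fun=> S0)).


(** The contribution of [psi] to [Lam [:: e] I]: with constant lists either all [k] colors of [e]
    survive or none does, while with [L] the survivors in [com L e] are counted. *)
Definition gain e I psi : rat :=
  kR * (~~ has (allc c0 psi) I)%:R -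
  #|[set c in com L e | ~~ has (fun f => (c \in com L f) && allc c0 psi f) I]|%:R.

Lemma com_const e : e != set0 -> com (fun=> S0) e = S0.
Proof.
case/set0Pn=> v ve; apply/setP => c; apply/comP/idP => [/(_ v ve)//|cS w _ //].
Qed.

Lemma Lam_star e I : e != set0 -> {in I, forall f : {set V}, f :&: e != set0} ->
  Lam [:: e] I = \sum_(psi | lcol0 psi && allc c0 psi e) gain e I psi.
Proof.
move=> e0 hI; rewrite /Lam.
rewrite (cnt_star hL hS0 hc0 e0 hI) (cnt_star (fun=> hS0) hS0 hc0 e0 hI).
rewrite !natr_sum -sumrB; apply: eq_bigr => psi _; rewrite /gain; congr (_ - _).
rewrite com_const // -hS0 -natrM; congr (_%:R).
have E c : c \in S0 -> has (fun f => (c \in com (fun=> S0) f) && allc c0 psi f) I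
    = has (allc c0 psi) I.
  move=> cS; apply: eq_in_has => f /hI fe; rewrite com_const ?cS //.
  by apply: contraNneq fe => ->; rewrite set0I.
case: (boolP (has (allc c0 psi) I)) => h /=.
  rewrite muln0; apply: eq_card0 => c; rewrite !inE.
  by case: (boolP (c \in S0)) => // cS; rewrite E // h.
rewrite muln1; apply: eq_card => c; rewrite !inE.
by case: (boolP (c \in S0)) => // cS; rewrite E // h.
Qed.

Lemma gain_nil e I psi : e != set0 -> ~~ has (allc c0 psi) I ->
  gain e I psi = alR e.
Proof.
move=> e0 h; rewrite /gain h mulr1 (_ : [set _ in _ | _] = com L e).
  by rewrite -[in LHS](al_com hL e0) natrD addrK.
apply/setP => c; rewrite !inE; apply/andb_idr => _.
by apply: contra h => /hasP[f fI /andP[_ hf]]; apply/hasP; exists f.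
Qed.

(** Once [f] is entirely [c0], constant lists leave no color. A color surviving for [L] lies outside
    [com L f] but in the list of a common vertex of [e] and [f], so at most [al k L f] survive. *)
Lemma gain_ge e I psi f : f :&: e != set0 -> f \in I -> allc c0 psi f ->
  - alR f <= gain e I psi.
Proof.
case/set0Pn=> u; rewrite inE => /andP[uf ue] fI hf.
have hh : has (allc c0 psi) I by apply/hasP; exists f.
rewrite /gain hh mulr0 add0r lerN2 ler_nat.
apply: (@leq_trans #|L u :\: com L f|); last first.
  by rewrite cardsD (setIidPr (com_sub L uf)) hL.
apply: subset_leq_card; apply/subsetP => c; rewrite 3!inE => /andP[ce].
move=> /hasPn/(_ f fI); rewrite hf andbT => -> /=.
by apply: (subsetP (com_sub L ue)); rewrite inE.
Qed.

(** With no edge of [I] entirely [c0] the gain is [alR e]. With one such edge [f] the bound reads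
    [- alR f], and each further one only weakens it. *)
Lemma gain_lin e I psi : e != set0 -> {in I, forall f : {set V}, f :&: e != set0} ->
  alR e - \sum_(f <- I | allc c0 psi f) (alR e + alR f) <= gain e I psi.
Proof.
move=> e0 hI; case: (boolP (has (allc c0 psi) I)) => [/hasP[f fI hf]|h].
  apply: le_trans (gain_ge (hI f fI) fI hf).
  rewrite (big_rem f) //= hf opprD addrA opprD addrA subrr add0r gerBl.
  by apply: sumr_ge0 => g _; rewrite addr_ge0.
rewrite gain_nil // -big_filter; case E: [seq _ <- _ | _] => [|g l].
  by rewrite big_nil subr0.
by move: h; rewrite has_filter E.
Qed.

(** With at least two edges entirely [c0], [gain_ge] is applied to the one of least deficit, and
    [gain_lin] has slack. The factor [2 / 3] is sharp for this argument: equality holds for exactly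
    two such edges with the same deficit as [e]. *)
Lemma gain_strong e I psi : e != set0 ->
  {in I, forall f : {set V}, (f :&: e != set0) && (al k L f <= al k L e)%N} ->
  alR e - \sum_(f <- I | allc c0 psi f) (alR e + alR f) +
  2 / 3 * ((2 <= count (allc c0 psi) I)%N%:R *
     (alR e + \sum_(f <- I | allc c0 psi f) alR f)) <= gain e I psi.
Proof.
move=> e0 hI; have hI' : {in I, forall f : {set V}, f :&: e != set0}.
  by move=> f /hI/andP[].
have [hc|hc] := boolP (2 <= count (allc c0 psi) I)%N; last first.
  by rewrite mul0r mulr0 addr0 gain_lin.
rewrite mul1r.
pose s := [seq f <- I | allc c0 psi f].
have ss : (2 <= size s)%N by rewrite size_filter.
have [|m ms hm] := @seq_argmin _ (al k L) s; first by case: (s) ss.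
have [hmpsi mI] : allc c0 psi m /\ m \in I by move: ms; rewrite mem_filter => /andP.
apply: le_trans (gain_ge (hI' m mI) mI hmpsi).
have hme : alR m <= alR e by rewrite ler_nat; case/andP: (hI m mI).
rewrite -!(big_filter I) -/s big_split /= big_const_seq count_predT iter_addr_0.
have h1 : alR m *+ size s <= \sum_(f <- s) alR f.
  rewrite -[X in _ *+ X]count_predT -iter_addr_0 -big_const_seq big_seq [leRHS]big_seq.
  by apply: ler_sum => f fs; rewrite ler_nat hm.
have m0 : 0 <= alR m by [].
move: h1 ss; set S := \sum_(_ <- _) _; rewrite -(mulr_natr (alR m)) -(mulr_natr (alR e)) => h1 ss.
have s2 : 2 <= (size s)%:R :> rat by rewrite ler_nat.
move: hme h1 s2 m0; move: (alR m) (alR e) ((size s)%:R : rat) => a b c hme h1 s2 m0.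
nra.
Qed.

Lemma sum_gain_lin e I : e != set0 ->
  \sum_(psi | lcol0 psi && allc c0 psi e)
     (alR e - \sum_(f <- I | allc c0 psi f) (alR e + alR f)) =
  kR ^+ (#|V| - #|e|) * alR e
    - \sum_(f <- I) (alR e + alR f) * kR ^+ (#|V| - #|e :|: f|).
Proof.
move=> e0; rewrite sumrB; congr (_ - _).
  rewrite big_const iter_addr_0 -(mulr_natl (alR e)); congr (_ * _).
  by rewrite -natrX -hS0 -(@card_allc V T S0 c0 e hc0) cardsE.
under eq_bigr => psi _ do rewrite big_mkcond /=.
rewrite exchange_big /=; apply: eq_bigr => f _.
rewrite -big_mkcondr /= big_const iter_addr_0.
rewrite -(mulr_natr (alR e + alR f)) -natrX; congr (_ * _%:R).
rewrite -hS0 -(@card_allc V T S0 c0 _ hc0); apply: eq_card => psi.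
rewrite !inE unfold_in -andbA; congr (_ && _).
apply/andP/allcP => [[/allcP h1 /allcP h2] v|h].
  by rewrite inE => /orP[]; [apply: h1|apply: h2].
by split; apply/allcP => v hv; apply: h; rewrite inE hv ?orbT.
Qed.

End Star.

(** * Edges that differ in one vertex *)

Section Near.
Variables (V : finType) (r : nat).
Implicit Types e f g : {set V}.

Definition near e f := #|e :&: f| == r.-1.

Lemma nearC e f : near e f = near f e.
Proof. by rewrite /near setIC. Qed.

Lemma near_meet e f : (2 < r)%N -> near e f -> f :&: e != set0.
Proof. by rewrite nearC /near -card_gt0 => r2 /eqP ->; lia. Qed.

Lemma card_meet_neq e f : #|e| = r -> #|f| = r -> e != f -> (#|e :&: f| < r)%N.
Proof.
move=> ce cf ef; rewrite ltn_neqAle -{2}ce subset_leq_card ?subsetIl // andbT.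
apply: contra ef => /eqP h.
have /eqP E1 : e :&: f == e by rewrite eqEcard subsetIl h ce /=.
have /eqP E2 : e :&: f == f by rewrite eqEcard subsetIr h cf /=.
by rewrite -{1}E1 E2.
Qed.

Lemma near_irr e : (0 < r)%N -> #|e| = r -> near e e = false.
Proof. by move=> r0 ce; rewrite /near setIid ce; apply/negbTE; lia. Qed.

(** Two subsets of [e] of size [r - 1] overlap because [2 * (r - 1) > r]. *)
Lemma near_meet2 e f g : (2 < r)%N -> #|e| = r -> near e f -> near e g -> f :&: g != set0.
Proof.
move=> r_gt2 ce /eqP ef /eqP eg.
have := cardsUI (e :&: f) (e :&: g).
have : (#|(e :&: f) :|: (e :&: g)| <= r)%N.
  by rewrite -ce subset_leq_card // subUset !subsetIl.
move=> h1 h2; apply: contraTneq r_gt2 => fg.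
have E : (e :&: f) :&: (e :&: g) = set0 by rewrite setIACA fg setI0.
by rewrite E cards0 in h2; lia.
Qed.

Lemma near_point e f : (0 < r)%N -> #|f| = r -> near e f ->
  exists2 v, v \notin e & f \subset v |: e.
Proof.
move=> r0 cf nf; have /cards1P[v fe] : #|f :\: e| == 1%N.
  by rewrite cardsD cf setIC; move/eqP: nf => ->; lia.
have : v \in f :\: e by rewrite fe set11.
rewrite inE => /andP[ve _]; exists v => //.
by rewrite -fe; apply/subsetP => u uf; rewrite !inE uf andbT; case: (u \in e).
Qed.

End Near.

(** * The first order bound, summed over all edges *)

Section MainBound.
Variables (V T : finType) (k : nat) (L : V -> {set T}) (S0 : {set T}) (r : nat).
Hypothesis hL : forall v, #|L v| = k.
Hypothesis hS0 : #|S0| = k.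
Hypothesis k_gt0 : (0 < k)%N.
Hypothesis r_gt2 : (2 < r)%N.
Implicit Types (e f g h x : {set V}) (B C I J s : seq {set V}).
Implicit Types (th psi : {ffun V -> T}).

Notation kR := (k%:R : rat).
Notation alR e := ((al k L e)%:R : rat).
Notation alS B := (\sum_(e <- B) alR e).
Notation Lam := (Lam L S0).
Notation F0 := (F0 (V:=V) S0).
Notation PO := (PO k L).
Notation lcol0 := (lcol (V:=V) (fun=> S0)).
Notation W := (kR ^+ (#|V| - r)).
Notation near := (near r).

Let kR_gt0 : 0 < kR. Proof. exact: kR_gt0. Qed.
Let kV_ge0 : 0 <= kR^-1. Proof. by rewrite invr_ge0 ltW. Qed.

Lemma pair_weight_le e f : #|e| = r -> #|f| = r -> e != f ->
  kR ^+ (#|V| - #|e :|: f|) <=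
    W * (if near e f then kR^-1 else kR^-1 * kR^-1).
Proof.
move=> ce cf ef; have lt := card_meet_neq ce cf ef.
have cU := cardsUI e f; rewrite ce cf in cU.
have leU : (#|e :|: f| <= #|V|)%N by apply: max_card.
(* [d] is the number of vertices that [f] adds to [e]: at least one, and at least two unless the
   edges are near. *)
have [d [Ed hd]] : exists d, (#|V| - r = (#|V| - #|e :|: f|) + d)%N /\
    ((if near e f then 1 else 2) <= d)%N.
  exists (#|e :|: f| - r)%N; rewrite /near; case: eqP => h; split;
    by clear hL hS0 r_gt2; lia.
rewrite Ed exprD -mulrA -[leLHS]mulr1 ler_wpM2l ?exprn_ge0 ?ler0n //.
have k1 : 1 <= kR by rewrite ler1n.
case: (near e f) hd => hd.
  by rewrite ler_pdivlMr // mul1r -[leLHS]expr1 ler_weXn2l.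
by rewrite mulrA !ler_pdivlMr // mul1r -expr2 ler_weXn2l.
Qed.

Lemma cnt_eq_mem (L' : V -> {set T}) B C C' : C =i C' -> cnt L' B C = cnt L' B C'.
Proof.
by move=> h; apply: eq_card => th; rewrite !inE (eq_has_r h).
Qed.

Lemma PO_perm b a C C' : perm_eq C C' -> PO b a C = PO b a C'.
Proof.
by move=> h; rewrite !PO_closed (perm_size h) (perm_big _ h).
Qed.

Definition meets e C := [seq f <- C | f :&: e != set0].

(* [X] leaves room for the extra gain that a monotone order provides. *)
Lemma Lam_step e C X : #|e| = r -> {in C, forall f : {set V}, #|f| = r} -> e \notin C ->
  W * alR e
    - \sum_(f <- meets e C) (alR e + alR f) * kR ^+ (#|V| - #|e :|: f|) + X
    <= Lam [:: e] (meets e C) ->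
  W * (alR e - kR^-1 * PO true (alR e) C - (kR^-1 - kR^-1 * kR^-1) *
     \sum_(f <- C | near e f) (alR e + alR f)) + X <= Lam [:: e] C.
Proof.
move=> ce cC eC; set I := meets e C; set J := [seq f <- C | f :&: e == set0].
have hp : perm_eq C (J ++ I).
  by rewrite perm_sym; apply/permPl; have := perm_filterC (fun f => f :&: e == set0) C.
have e0 : e != set0 by rewrite -card_gt0; lia.
have -> : Lam [:: e] C = Lam [:: e] (J ++ I).
  by rewrite /Lam !(cnt_eq_mem _ _ (perm_mem hp)).
have I0 : set0 \notin I by rewrite mem_filter set0I eqxx.
have hJ : {in J, forall h : {set V}, (2 < #|h|)%N && [disjoint h & e]}.
  by move=> h; rewrite mem_filter -setI_eq0 => /andP[-> /cC ->]; rewrite r_gt2.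
have ce2 : (2 < #|e|)%N by rewrite ce.
have := Lam_split hL hS0 k_gt0 ce2 I0 hJ.
rewrite (F0_edge hS0 k_gt0 e0) ce -(PO_perm _ _ hp).
have ha : 0 <= alR e by [].
(* [Lam_split] leaves [PO true (alR e) I] to spare. Its singletons pay a weight [k ^- 2] for every
   pair of meeting edges, so only the excess [k ^- 1 - k ^- 2] of the near pairs remains. *)
have od := PO_odd_ge L k_gt0 I ha.
have W0 : 0 <= W by rewrite exprn_ge0 // ltW.
have key : \sum_(f <- I) (alR e + alR f) * kR ^+ (#|V| - #|e :|: f|) <=
   W * (kR^-1 * kR^-1 * \sum_(f <- I) (alR e + alR f) + (kR^-1 - kR^-1 * kR^-1) *
     \sum_(f <- C | near e f) (alR e + alR f)).
  have -> : \sum_(f <- C | near e f) (alR e + alR f)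
     = \sum_(f <- I | near e f) (alR e + alR f).
    rewrite big_filter_cond; apply: eq_bigl => f.
    by apply/esym/andb_idl; apply: near_meet.
  rewrite [X in _ * (_ + _ * X)]big_mkcond /= !mulr_sumr -big_split /= mulr_sumr.
  rewrite big_seq [leRHS]big_seq; apply: ler_sum => f.
  rewrite mem_filter => /andP[_ fC].
  have ef : e != f by apply: contraNneq eC => ->.
  have ae : 0 <= alR e + alR f by rewrite addr_ge0.
  apply: le_trans (ler_wpM2l ae (pair_weight_le ce (cC f fC) ef)) _.
  by case: (near e f); rewrite le_eqVlt; apply/orP; left; apply/eqP; ring.
have := ler_wpM2l (mulr_ge0 W0 kV_ge0) od.
move: key; set s1 := \sum_(f <- I) _ * _; set s2 := \sum_(f <- I) _.
set s3 := \sum_(f <- C | _) _; set w := W; set u := kR^-1.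
set a := PO _ _ I; set b := PO _ _ C; set a4 := Lam _ I; set a5 := Lam _ (J ++ I).
by clearbody s1 s2 s3 w u a b a4 a5 => h1 h2 h3 h4; lra.
Qed.

Definition coef m (g : nat) : rat :=
  1 - kR^-1 * pp k true m.-1 - (kR^-1 - kR^-1 * kR^-1) * g%:R.

Definition total s := \sum_(e <- s) alR e * coef (size s) (count (near e) s).

(** Each single step depends on the order of the edges, but every pair contributes the sum of its
    two deficits exactly once, so the result is symmetric. *)
Lemma total_cons e C : #|e| = r ->
  total (e :: C) = total C + (alR e - kR^-1 * PO true (alR e) C
    - (kR^-1 - kR^-1 * kR^-1) * \sum_(f <- C | near e f) (alR e + alR f)).
Proof.
move=> ce; rewrite PO_closed /total /coef.
have E s : \sum_(x <- s) alR x * (1 - kR^-1 * pp k true (size s).-1 -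
     (kR^-1 - kR^-1 * kR^-1) * (count (near x) s)%:R) =
   alS s * (1 - kR^-1 * pp k true (size s).-1) - (kR^-1 - kR^-1 * kR^-1) *
     \sum_(x <- s) alR x * (count (near x) s)%:R.
  rewrite mulr_suml mulr_sumr -sumrB; apply: eq_bigr => x _; ring.
rewrite !E !big_cons /= near_irr ?add0n //; last exact: ltn_trans r_gt2.
rewrite big_split /= big_const_seq iter_addr_0 -(mulr_natr (alR e)).
have -> : \sum_(f <- C) alR f * ((near f e + count (near f) C)%N)%:R =
   \sum_(f <- C | near e f) alR f + \sum_(f <- C) alR f * (count (near f) C)%:R.
  rewrite [X in _ = X + _]big_mkcond -big_split /=; apply: eq_bigr => f _.
  by rewrite natrD mulrDr nearC; case: near; rewrite ?mulr1 ?mulr0.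
case: C => [|y C]; first by rewrite !big_nil /=; ring.
by rewrite [size _]/= ppS /=; ring.
Qed.

Lemma Lam_nil_nil : Lam [::] [::] = 0.
Proof.
rewrite /Lam !cnt_blocks; apply/eqP; rewrite subr_eq0; apply/eqP; congr (_%:R).
apply: eq_bigr => v _.
have bc (L' : V -> {set T}) : bcom L' [::] v = L' v.
  by rewrite /bcom (big_pred1 v).
by rewrite !bc hL hS0.
Qed.

Variable c0 : T.
Hypothesis hc0 : c0 \in S0.

Lemma main_lin s : uniq s -> {in s, forall e : {set V}, #|e| = r} ->
  W * total s <= - Lam [::] s.
Proof.
elim: s => [|e C IH] /=; first by rewrite Lam_nil_nil /total big_nil mulr0 oppr0.
move=> /andP[eC uC] hs.
have hC : {in C, forall f : {set V}, #|f| = r}.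
  by move=> f fC; apply: hs; rewrite inE fC orbT.
have ce : #|e| = r by apply: hs; rewrite mem_head.
have e0 : e != set0 by rewrite -card_gt0; lia.
have hI : {in meets e C, forall f : {set V}, f :&: e != set0}.
  by move=> f; rewrite mem_filter => /andP[].
have st : W * alR e
    - \sum_(f <- meets e C) (alR e + alR f) * kR ^+ (#|V| - #|e :|: f|) + 0
    <= Lam [:: e] (meets e C).
  rewrite addr0 -{1}ce -(sum_gain_lin L hS0 hc0 _ e0) (Lam_star hL hS0 hc0 e0 hI).
  by apply: ler_sum => psi _; apply: gain_lin.
have := Lam_step ce hC eC st; have := IH uC hC.
rewrite Lam_cons total_cons // mulrDr => h1 h2; lra.
Qed.

End MainBound.

(** * Triangles of edges, and the case of five edges and three colors *)

Lemma count_ge2 (I : eqType) (p : pred I) (s : seq I) x y :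
  x \in s -> y \in s -> x != y -> p x -> p y -> (2 <= count p s)%N.
Proof.
move=> xs ys xy px py; rewrite -size_filter.
apply: (@uniq_leq_size _ [:: x; y]); first by rewrite /= inE xy.
by move=> z; rewrite !inE => /orP[] /eqP ->; rewrite mem_filter ?px ?py.
Qed.

Section Triangles.
Variables (V T : finType) (k : nat) (L : V -> {set T}) (S0 : {set T}) (r : nat).
Hypothesis hL : forall v, #|L v| = k.
Hypothesis hS0 : #|S0| = k.
Hypothesis k_gt0 : (0 < k)%N.
Variable c0 : T.
Hypothesis hc0 : c0 \in S0.
Hypothesis r_gt2 : (2 < r)%N.
Implicit Types (e f g h x z : {set V}) (B C I J s : seq {set V}).
Implicit Types (th psi : {ffun V -> T}).

Notation kR := (k%:R : rat).
Notation alR e := ((al k L e)%:R : rat).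
Notation Lam := (Lam L S0).
Notation lcol0 := (lcol (V:=V) (fun=> S0)).
Notation W := (kR ^+ (#|V| - r)).
Notation total := (total k L r).

Definition xgain e C psi : rat :=
  (2 <= count (allc c0 psi) (meets e C))%N%:R *
     (alR e + \sum_(f <- meets e C | allc c0 psi f) alR f).

Fixpoint xtot psi s : rat :=
  if s is e :: C then (if allc c0 psi e then xgain e C psi else 0) + xtot psi C else 0.

Definition tri psi s z :=
  [exists f : {set V}, [exists g : {set V}, [&& f \in s, g \in s, f != g, f != z, g != z,
    f :&: z != set0, g :&: z != set0, f :&: g != set0, allc c0 psi f & allc c0 psi g]]].

Lemma xgain_ge0 e C psi : 0 <= xgain e C psi.
Proof. by rewrite mulr_ge0 // addr_ge0 // sumr_ge0. Qed.

(** A triangle through [z] either avoids the head [e] or contains it. In the second case its two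
    other edges belong to [meets e C], which makes [xgain] at [e] active. *)
Lemma tri_cons psi e C z : allc c0 psi z -> z \in e :: C ->
  tri psi (e :: C) z ->
  (z != e) && tri psi C z ||
  [&& allc c0 psi e, (2 <= count (allc c0 psi) (meets e C))%N &
      (z == e) || (z :&: e != set0)].
Proof.
move=> hz zs /existsP[f /existsP[g /and5P[fs gs fg fz]]].
case/and5P=> gz mfz mgz mfg /andP[hf hg].
have mem x : x \in e :: C -> x != e -> x \in C by rewrite inE => /orP[/eqP ->|//]; rewrite eqxx.
have inM x : x \in C -> x :&: e != set0 -> x \in meets e C.
  by move=> xC xe; rewrite mem_filter xe.
have [ze|ze] /= := eqVneq z e.
  subst e; rewrite hz /= andbT.
  by apply: (@count_ge2 _ _ _ f g) => //; apply: inM => //; apply: mem.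
have zC := mem z zs ze.
have [fe|fe] := eqVneq f e.
  subst e; rewrite hf setIC mfz andbT; apply/orP; right.
  by apply: (@count_ge2 _ _ _ g z) => //; apply: inM; rewrite ?(setIC _ f) //;
    apply: mem => //; rewrite eq_sym.
have [ge|ge] := eqVneq g e.
  subst e; rewrite hg setIC mgz andbT; apply/orP; right.
  by apply: (@count_ge2 _ _ _ f z) => //; apply: inM; rewrite ?(setIC z) //; apply: mem.
apply/orP; left; apply/existsP; exists f; apply/existsP; exists g.
by rewrite (mem f) // (mem g) // fg fz gz mfz mgz mfg hf hg.
Qed.

(** Each [z] is paid for at the first listed edge of one of its triangles: there [xgain] includes
    the deficits of that edge and of all later edges that meet it and are entirely [c0]. *)
Lemma xtot_tri psi s : uniq s ->
  \sum_(z <- s | allc c0 psi z && tri psi s z) alR z <= xtot psi s.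
Proof.
elim: s => [|e C IH] /=; first by rewrite big_nil.
case/andP=> eC /IH {}IH.
have hx : 0 <= (if allc c0 psi e then xgain e C psi else 0).
  by case: ifP => // _; apply: xgain_ge0.
pose b := allc c0 psi e && (2 <= count (allc c0 psi) (meets e C))%N.
apply: le_trans (lerD (_ : b%:R * (alR e + \sum_(f <- meets e C | allc c0 psi f) alR f)
   <= _) IH); last first.
  by rewrite /b /xgain; case: (allc c0 psi e); rewrite //= mul0r.
rewrite /meets big_filter_cond mulrDr -addrA big_cons.
have A1 : (if allc c0 psi e && tri psi (e :: C) e then
    alR e + \sum_(j <- C | allc c0 psi j && tri psi (e :: C) j) alR j
    else \sum_(j <- C | allc c0 psi j && tri psi (e :: C) j) alR j)
   <= b%:R * alR e + \sum_(j <- C | allc c0 psi j && tri psi (e :: C) j) alR j.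
  case: ifP => [/andP[he te]|_]; last by rewrite lerDr mulr_ge0.
  rewrite lerD2r; have := tri_cons he (mem_head _ _) te.
  by rewrite eqxx /= andbT -/b => ->; rewrite mul1r.
apply: le_trans A1 _; rewrite lerD2l mulr_sumr !(big_mkcond (fun f => _ && _)) /=.
rewrite -big_split /= big_seq [leRHS]big_seq; apply: ler_sum => z zC.
have ze : z != e by apply: contraNneq eC => <-.
have zs : z \in e :: C by rewrite inE zC orbT.
case: (boolP (allc c0 psi z)) => [hz|_] /=; last by rewrite andbF addr0.
rewrite andbT; case: (boolP (tri psi (e :: C) z)) => [tz|_]; last first.
  by rewrite addr_ge0 //; case: ifP => // _; rewrite mulr_ge0.
have := tri_cons hz zs tz; rewrite ze (negPf ze) /= andbA -/b.
case: (tri psi C z) => [_|/= /andP[-> ->]]; last by rewrite mul1r addr0.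
by rewrite lerDr; case: ifP => // _; rewrite mulr_ge0.
Qed.

(** The order puts the edge of largest deficit at the head, as [gain_strong] requires. *)
Lemma main_strong s : uniq s -> {in s, forall e : {set V}, #|e| = r} ->
  pairwise (fun e f => al k L f <= al k L e)%N s ->
  W * total s + 2 / 3 * \sum_(psi | lcol0 psi) xtot psi s <= - Lam [::] s.
Proof.
elim: s => [|e C IH] /=.
  by rewrite (Lam_nil_nil hL hS0) /total big_nil mulr0 oppr0 big1 // mulr0 addr0.
move=> /andP[eC uC] hs /andP[/allP ale pC].
have hC : {in C, forall f : {set V}, #|f| = r}.
  by move=> f fC; apply: hs; rewrite inE fC orbT.
have ce : #|e| = r by apply: hs; rewrite mem_head.
have e0 : e != set0 by rewrite -card_gt0; lia.
have hI : {in meets e C, forall f : {set V}, (f :&: e != set0) && (al k L f <= al k L e)%N}.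
  by move=> f; rewrite mem_filter => /andP[-> /ale].
have hI' : {in meets e C, forall f : {set V}, f :&: e != set0}.
  by move=> f /hI/andP[].
have st : W * alR e
    - \sum_(f <- meets e C) (alR e + alR f) * kR ^+ (#|V| - #|e :|: f|)
    + 2 / 3 * (\sum_(psi | lcol0 psi && allc c0 psi e) xgain e C psi)
    <= Lam [:: e] (meets e C).
  rewrite -{1}ce -(sum_gain_lin L hS0 hc0 _ e0) (Lam_star hL hS0 hc0 e0 hI').
  rewrite mulr_sumr -big_split /=.
  by apply: ler_sum => psi _; apply: gain_strong.
have := Lam_step hL hS0 k_gt0 r_gt2 ce hC eC st; have := IH uC hC pC.
rewrite Lam_cons total_cons // mulrDr.
have -> : \sum_(psi | lcol0 psi) ((if allc c0 psi e then xgain e C psi else 0) + xtot psi C)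
   = \sum_(psi | lcol0 psi && allc c0 psi e) xgain e C psi
     + \sum_(psi | lcol0 psi) xtot psi C.
  by rewrite big_split /= -big_mkcondr.
move=> h1 h2; lra.
Qed.

Notation Nc U := #|[set psi | lcol0 psi && allc c0 psi U]|.

(** Given that [e] is [c0], at least two of three distinct outside points are [c0] with probability
    [3 / 9 - 2 / 27 = 7 / 27]; if two of the points coincide, the probability is at least
    [1 / 3]. *)
Lemma two_of_three e (u v w : V) : #|e| = r ->
  u \notin e -> v \notin e -> w \notin e -> k = 3 ->
  7 / 27 * W <= #|[set psi | [&& lcol0 psi, allc c0 psi e &
      [|| allc c0 psi [set u; v], allc c0 psi [set u; w] | allc c0 psi [set v; w]]]]|%:R :> rat.
Proof.
move=> ce ue ve we k3; set A := [set _ | _].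
have allcU (U U' : {set V}) psi : allc c0 psi (U :|: U') = allc c0 psi U && allc c0 psi U'.
  apply/allcP/andP => [h|[/allcP h1 /allcP h2] x].
    by split; apply/allcP => x hx; apply: h; rewrite inE hx ?orbT.
  by rewrite inE => /orP[]; [apply: h1 | apply: h2].
have NE (U : {set V}) : U \subset ~: e -> (Nc (e :|: U) = 3 ^ (#|V| - r - #|U|))%N.
  move=> Ue; rewrite card_allc // hS0 k3 cardsU ce.
  rewrite (_ : e :&: U = set0) ?cards0; last first.
    by apply/eqP; rewrite setI_eq0 disjoint_sym disjoints_subset.
  by congr (3 ^ _)%N; lia.
have sub (x y : V) : x \notin e -> y \notin e -> [set x; y] \subset ~: e.
  by move=> xe ye; apply/subsetP => a; rewrite !inE => /orP[] /eqP ->.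
have dup (x : V) : x \notin e ->
   (forall psi, allc c0 psi [set x; x] -> [|| allc c0 psi [set u; v],
       allc c0 psi [set u; w] | allc c0 psi [set v; w]]) -> 7 / 27 * W <= #|A|%:R.
  move=> xe h.
  have : (Nc (e :|: [set x; x]) <= #|A|)%N.
    apply: subset_leq_card; apply/subsetP => psi; rewrite !inE allcU.
    by case/and3P=> -> -> /h.
  rewrite (NE _ (sub _ _ xe xe)) setUid cards1.
  rewrite -(ler_nat rat).
  have nr : (r < #|V|)%N.
    rewrite -ce -cardsT; apply: proper_card; rewrite properT.
    by apply: contra xe => /eqP ->; rewrite inE.
  move=> h1; apply: le_trans h1; rewrite k3.
  have [q ->] : exists q, (#|V| - r = q.+1)%N by exists (#|V| - r - 1)%N; lia.
  rewrite subn1 /= natrX exprS.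
  have : 0 <= 3%:R ^+ q :> rat by rewrite exprn_ge0.
  lra.
have [uv|uv] := eqVneq u v.
  by apply: (dup u) => // psi h; rewrite -uv h.
have [uw|uw] := eqVneq u w.
  by apply: (dup u) => // psi h; rewrite -uw h orbT.
have [vw|vw] := eqVneq v w.
  by apply: (dup v) => // psi h; rewrite -vw h !orbT.
have c3 : #|[set u; v] :|: [set w]| = 3%N.
  by rewrite setUC cardsU1 !inE negb_or eq_sym uw eq_sym vw cards2 uv.
have s3 : [set u; v] :|: [set w] \subset ~: e.
  by rewrite subUset sub // sub1set inE.
have nr : (r + 3 <= #|V|)%N.
  rewrite -c3 -ce -(cardsC e) leq_add2l; exact: subset_leq_card.
have key : (Nc (e :|: [set u; v]) + Nc (e :|: [set u; w]) + Nc (e :|: [set v; w])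
    <= #|A| + 2 * Nc (e :|: ([set u; v] :|: [set w])))%N.
  have cE (Q : pred {ffun V -> T}) : #|[set psi | Q psi]| = (\sum_psi (Q psi : nat))%N.
    by rewrite -sum1dep_card big_mkcond; apply: eq_bigr => psi _; case: (Q psi).
  rewrite mul2n -addnn /A !cE -!big_split /=.
  apply: leq_sum => psi _; rewrite !allcU.
  have a1 (x : V) : allc c0 psi [set x] = (psi x == c0).
    by apply/allcP/eqP => [->//|h y]; rewrite inE ?set11 // => /eqP ->.
  rewrite !a1; case: (lcol0 psi) => //=; case: (allc c0 psi e) => //=.
  by case: (psi u == c0); case: (psi v == c0); case: (psi w == c0).
have c2 (x y : V) : x != y -> #|[set x; y]| = 2%N by rewrite cards2 => ->.
rewrite !NE ?sub // c3 !c2 // in key.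
move: key; rewrite k3.
have [q ->] : exists q, (#|V| - r = q.+3)%N by exists (#|V| - r - 3)%N; lia.
have -> : (q.+3 - 2 = q.+1)%N by lia.
have -> : (q.+3 - 3 = q)%N by lia.
rewrite expnS => h; have : (7 * 3 ^ q <= #|A|)%N.
  by move: h; move: (3 ^ q)%N #|A| => Q N; clear; lia.
rewrite -(ler_nat rat) natrM natrX !exprS.
have : 0 <= 3%:R ^+ q :> rat by rewrite exprn_ge0.
lra.
Qed.

Lemma five_edges_k3 s : uniq s -> {in s, forall e : {set V}, #|e| = r} ->
  pairwise (fun e f => al k L f <= al k L e)%N s ->
  k = 3 -> size s = 5%N -> {in s, forall e : {set V}, (count (near r e) s <= 3)%N} ->
  0 <= - Lam [::] s.
Proof.
move=> us hs ps k3 s5 hc; apply: le_trans (main_strong us hs ps).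
have W0 : 0 <= W by rewrite exprn_ge0.
have h1 : \sum_(psi | lcol0 psi) \sum_(z <- s | allc c0 psi z && tri psi s z) alR z
   <= \sum_(psi | lcol0 psi) xtot psi s.
  by apply: ler_sum => psi _; apply: xtot_tri.
have h2 : \sum_(z <- s) (count (near r z) s == 3%N)%:R * (alR z * (7 / 27 * W)) <=
    \sum_(psi | lcol0 psi) \sum_(z <- s | allc c0 psi z && tri psi s z) alR z.
  under [leRHS]eq_bigr => psi _ do rewrite big_mkcond /=.
  rewrite exchange_big /= big_seq [leRHS]big_seq; apply: ler_sum => z zs.
  have cz := hs z zs.
  rewrite -big_mkcondr /=; case: eqP => [c3|_]; last by rewrite mul0r sumr_ge0.
  rewrite mul1r big_const iter_addr_0 -(mulr_natr (alR z)).
  apply: ler_wpM2l; first exact: ler0n.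
  (* Each of the three edges near [z] has one vertex outside [z], and any two of them meet. Once [z]
     is [c0], two of these vertices in color [c0] produce a triangle. *)
  pose l := [seq f <- s | near r z f].
  have sl : size l = 3%N by rewrite size_filter.
  have ul : uniq l by rewrite filter_uniq.
  have hl : {in l, forall f : {set V}, [/\ f \in s, near r z f & f != z]}.
    move=> f; rewrite mem_filter => /andP[nf fs]; split=> //.
    by apply: contraTneq nf => ->; rewrite near_irr // (ltn_trans _ r_gt2).
  clearbody l; case: l sl ul hl => [sl|f1 l]; first discriminate sl.
  case: l => [sl|f2 l]; first discriminate sl.
  case: l => [sl|f3 l]; first discriminate sl.
  case: l => [_ ul hl|f4 l sl]; last discriminate sl.
  have [f1s n1 z1] := hl f1 (mem_head _ _).
  have [f2s n2 z2] : [/\ f2 \in s, near r z f2 & f2 != z] by apply: hl; rewrite !inE eqxx orbT.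
  have [f3s n3 z3] : [/\ f3 \in s, near r z f3 & f3 != z] by apply: hl; rewrite !inE eqxx !orbT.
  have [v1 v1z s1] := near_point (ltnW (ltnW r_gt2)) (hs _ f1s) n1.
  have [v2 v2z s2] := near_point (ltnW (ltnW r_gt2)) (hs _ f2s) n2.
  have [v3 v3z s3] := near_point (ltnW (ltnW r_gt2)) (hs _ f3s) n3.
  apply: le_trans (two_of_three cz v1z v2z v3z k3) _; rewrite ler_nat.
  apply: subset_leq_card; apply/subsetP => psi; rewrite inE => /and3P[lp az h].
  rewrite unfold_in lp az /=.
  have allcS (f : {set V}) v : f \subset v |: z -> psi v = c0 -> allc c0 psi f.
    move=> /subsetP sf hv; apply/allcP => x /sf; rewrite !inE => /orP[/eqP -> //|].
    by move/allcP: az; apply.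
  have mk f g : f \in s -> g \in s -> f != g -> near r z f -> near r z g -> f != z -> g != z ->
      allc c0 psi f -> allc c0 psi g -> tri psi s z.
    move=> fs gs fg nf ng fz gz hf hg; apply/existsP; exists f; apply/existsP; exists g.
    rewrite fs gs fg fz gz hf hg (near_meet r_gt2 nf) (near_meet r_gt2 ng).
    by rewrite (near_meet2 r_gt2 cz nf ng).
  move: ul; rewrite /= !inE negb_or andbT => /andP[/andP[n12 n13] n23].
  case/or3P: h => /allcP h.
  - apply: (mk f1 f2) => //; [apply: (allcS _ v1) | apply: (allcS _ v2)] => //;
      by apply: h; rewrite !inE eqxx ?orbT.
  - apply: (mk f1 f3) => //; [apply: (allcS _ v1) | apply: (allcS _ v3)] => //;
      by apply: h; rewrite !inE eqxx ?orbT.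
  - apply: (mk f2 f3) => //; [apply: (allcS _ v2) | apply: (allcS _ v3)] => //;
      by apply: h; rewrite !inE eqxx ?orbT.
have h3 : 0 <= W * total s + 2 / 3 *
    \sum_(z <- s) (count (near r z) s == 3%N)%:R * (alR z * (7 / 27 * W)).
  rewrite /total mulr_sumr mulr_sumr -big_split /= big_seq; apply: sumr_ge0 => z zs.
  (* For three near edges the coefficient is [41 / 81 - 54 / 81 = - 13 / 81], and the triangles
     return [2 / 3 * 7 / 27 = 14 / 81]. *)
  have cg (g : nat) : coef k 5 g = 41 / 81 - 2 / 9 * g%:R.
    rewrite /coef (_ : pp k true 5.-1 = 40 / 27) ?k3; first by field.
    by apply/eqP; rewrite /pp; vm_compute.
  have a0 : 0 <= W * alR z by rewrite mulr_ge0.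
  have := hc z zs; rewrite s5 cg; case: eqP => [-> _|n3 l3].
    rewrite mul1r; move: a0; set w := W; set a := alR z; clearbody w a.
    lra.
  have l2 : (count (near r z) s)%:R <= 2 :> rat by rewrite ler_nat; lia.
  rewrite mul0r mulr0 addr0 mulrA; apply: mulr_ge0; first exact: a0.
  move: l2; set c := _%:R; clearbody c; lra.
lra.
Qed.

End Triangles.

(** * Edges of zero deficit under relabelling *)

Section ZeroDeficit.
Variables (V T : finType) (k : nat) (L : V -> {set T}).
Hypothesis hL : forall v, #|L v| = k.
Implicit Types (f : {set V}) (th : {ffun V -> T}).

Lemma al0_const f u v : f != set0 -> al k L f = 0%N -> u \in f -> v \in f -> L u = L v.
Proof.
move=> f0 af uf vf; have cf := al_com hL f0; rewrite af add0n in cf.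
have E w : w \in f -> com L f = L w.
  by move=> wf; apply/eqP; rewrite eqEcard com_sub // hL cf /=.
by rewrite -(E u uf) (E v vf).
Qed.

(** All lists on [f] coincide, so a single injective map recolors the whole edge. *)
Lemma mono_relabel (phi : {set T} -> T -> T) th f : f != set0 -> al k L f = 0%N ->
  (forall v, {in L v &, injective (phi (L v))}) -> lcol L th ->
  mono th f = mono [ffun v => phi (L v) (th v)] f.
Proof.
move=> f0 af inj /forallP hth.
apply/monoP/monoP => m u v uf vf; have Luv := al0_const f0 af uf vf.
  by rewrite !ffunE (m u v) // Luv.
have := m u v uf vf; rewrite !ffunE Luv; apply: inj; rewrite -?Luv ?hth //.
by rewrite Luv hth.
Qed.

End ZeroDeficit.

(** * The case of five edges and two colors *)

Section TwoColors.
Variables (V T : finType) (k : nat) (L : V -> {set T}) (S0 : {set T}) (r : nat).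
Hypothesis hL : forall v, #|L v| = k.
Hypothesis hS0 : #|S0| = k.
Hypothesis k_gt0 : (0 < k)%N.
Variable c0 : T.
Hypothesis hc0 : c0 \in S0.
Hypothesis r_gt2 : (2 < r)%N.
Implicit Types (e f g h x z : {set V}) (B C I J s : seq {set V}).
Implicit Types (th psi : {ffun V -> T}).

Notation kR := (k%:R : rat).
Notation Lam := (Lam L S0).
Notation F0 := (F0 (V:=V) S0).
Notation cnt0 := (cnt (V:=V) (fun=> S0)).
Notation lcol0 := (lcol (V:=V) (fun=> S0)).

Lemma cnt_al0 C : set0 \notin C -> {in C, forall f : {set V}, al k L f = 0%N} ->
  cnt L [::] C = cnt0 [::] C.
Proof.
move=> C0 hC; have [phi hphi] := list_relabel hL hS0 c0 hc0.
apply: (card_relabel hL hS0 (phi := phi)) => [v|th hth].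
  by case: (hphi v).
congr (~~ _); apply: eq_in_has => f fC; apply: (mono_relabel hL) => //.
- by apply: contraNneq C0 => <-.
- exact: hC.
- by move=> v; case: (hphi v).
Qed.

(** By relabelling, every common color of [e] accounts for the same number of colorings, for [L] as
    for constant lists; there are [#|com L e|] such colors in one case and [k] in the other. *)
Lemma cnt_edge_al0 e C : e != set0 -> set0 \notin C ->
  {in C, forall f : {set V}, al k L f = 0%N} ->
  (k * cnt L [:: e] C = #|com L e| * cnt0 [:: e] C)%N.
Proof.
move=> e0 C0 hC.
have key (L' : V -> {set T}) (c : T) : (forall v, #|L' v| = k) ->
    {in C, forall f : {set V}, al k L' f = 0%N} -> c \in com L' e ->
  #|[set th | lcol L' th && (allc c th e && ~~ has (mono th) C)]|
    = #|[set th | lcol0 th && (allc c0 th e && ~~ has (mono th) C)]|.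
  move=> hL' hC' ce; have [phi hphi] := list_relabel hL' hS0 c hc0.
  apply: (card_relabel hL' hS0 (phi := phi)) => [v|th hth]; first by case: (hphi v).
  congr (_ && ~~ _).
    move/comP: ce => ce; apply: eq_forallb_in => v ve; rewrite ffunE.
    have [inj _ /(_ (ce v ve)) <-] := hphi v; apply/eqP/eqP => [->//|].
    by apply: inj; [move/forallP: hth; apply | apply: ce].
  apply: eq_in_has => f fC.
  have f0 : f != set0 by apply: contraNneq C0 => <-.
  have inj v : {in L' v &, injective (phi (L' v))} by case: (hphi v).
  exact: (mono_relabel hL' f0 (hC' f fC) inj hth).
rewrite !cnt_by_color // (eq_bigr _ (fun c ce => key L c hL hC ce)).
have hS : {in C, forall f : {set V}, al k (fun=> S0) f = 0%N}.
  move=> f fC; have f0 : f != set0 by apply: contraNneq C0 => <-.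
  by rewrite /al com_const // hS0 subnn.
rewrite [in RHS](eq_bigr _ (fun c ce => key (fun=> S0) c (fun=> hS0) hS ce)).
by rewrite !sum_nat_const com_const // hS0 mulnCA.
Qed.

Lemma cnt_antimono (L' : V -> {set T}) B C C' : {subset C <= C'} ->
  (cnt L' B C' <= cnt L' B C)%N.
Proof.
move=> sub; apply: subset_leq_card; apply/subsetP => th; rewrite !inE.
case/and3P=> -> -> /= /hasPn h; apply/hasPn => f /sub; exact: h.
Qed.

Lemma cnt_union_bound (L' : V -> {set T}) A C :
  (cnt L' [::] C <= cnt L' [::] (A ++ C) + \sum_(e <- A) cnt L' [:: e] C)%N.
Proof.
elim: A => [|e A IH] /=; first by rewrite big_nil addn0.
rewrite big_cons; apply: leq_trans IH _; rewrite addnCA addnA leq_add2r.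
rewrite -(cnt_cons L' [::] e (A ++ C)) addnC leq_add2r.
by apply: cnt_antimono => f fC; rewrite mem_cat fC orbT.
Qed.

Lemma card_bmap_near e f : #|f| = r -> near r e f -> #|bmap [:: e] @: f| = 2%N.
Proof.
move=> cf nf; rewrite card_bmap1 (near_meet r_gt2 nf) cardsD cf setIC.
by move/eqP: nf => ->; clear -r_gt2; lia.
Qed.

Lemma card_bmap_far e f : #|e| = r -> #|f| = r -> e != f -> ~~ near r e f ->
  (2 < #|bmap [:: e] @: f|)%N.
Proof.
move=> ce cf ef nf; rewrite card_bmap1 cardsD cf.
have := card_meet_neq ce cf ef; move: nf; rewrite /near setIC.
case: (eqVneq (f :&: e) set0) => [->|_]; rewrite ?cards0 /=; clear -r_gt2; lia.
Qed.

Lemma card_bmap_cons B x f : (#|bmap (x :: B) @: f| <= #|bmap B @: f|)%N.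
Proof.
have -> : bmap (x :: B) @: f = bmap (x :: B) @: (bmap B @: f).
  by rewrite -imset_comp; apply: eq_imset => v; rewrite [RHS]/= -/(bmap (x :: B)) bmap_step.
exact: leq_imset_card.
Qed.

Lemma cnt_sum (L' : V -> {set T}) B C : (cnt L' B C)%:R =
  \sum_(psi | lcol L' psi) (all (mono psi) B && ~~ has (mono psi) C)%:R :> rat.
Proof.
rewrite /cnt -sum1dep_card natr_sum big_mkcondr /=.
by apply: eq_bigr => psi _; case: ifP.
Qed.

Hypothesis k2 : k = 2%N.

Let two_V : kR^-1 = 1 / 2. Proof. by rewrite k2 div1r. Qed.

Lemma F0_near e f : #|e| = r -> #|f| = r -> near r e f -> F0 [:: f; e] = F0 [:: e] / 2.
Proof.
move=> ce cf nf; have f0 : f != set0 by rewrite -card_gt0 cf (ltn_trans _ r_gt2).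
have := F0_cons hS0 k_gt0 [:: e] f0; rewrite card_bmap_near //= expr1 k2 => <-.
by rewrite mulfK.
Qed.

Lemma F0_far e f : #|e| = r -> #|f| = r -> e != f -> ~~ near r e f ->
  F0 [:: f; e] <= F0 [:: e] / 4.
Proof.
move=> ce cf ef nf.
have f0 : f != set0 by rewrite -card_gt0 cf (ltn_trans _ r_gt2).
have e0 : e != set0 by rewrite -card_gt0 ce (ltn_trans _ r_gt2).
have := F0_pair_le hS0 k_gt0 e0 f0 (card_bmap_far ce cf ef nf).
by rewrite two_V; lra.
Qed.

(** Given that [e] is monochromatic, [f] is not with probability [1 / 2]. Each of the three other
    edges is monochromatic while [f] is not with probability at most [1 / 8], and
    [1 / 2 - 3 / 8 = 1 / 8] remains. *)
Lemma lonely_edge e f s : #|e| = r -> uniq s -> {in s, forall g : {set V}, #|g| = r} ->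
  size s = 5%N -> e \in s -> f \in s -> near r e f -> (count (near r e) s <= 1)%N ->
  F0 [:: e] / 8 <= \sum_(psi | lcol0 psi)
     (mono psi e && (count (mono psi) s == 1%N))%:R.
Proof.
move=> ce us hs s5 es fs nf cn; have cf := hs f fs.
have ef : e != f by apply: contraTneq nf => <-; rewrite near_irr //; lia.
pose l := rem f (rem e s).
have fr : f \in rem e s by rewrite mem_rem_uniq // inE eq_sym ef.
have ps : perm_eq s (e :: f :: l).
  apply: perm_trans (perm_to_rem es) _; rewrite perm_cons; exact: perm_to_rem.
have sl : size l = 3%N by have := perm_size ps; rewrite s5 => -[].
have ul : uniq (e :: f :: l) by rewrite -(perm_uniq ps).
have hl : {in l, forall g : {set V}, [/\ #|g| = r, e != g & ~~ near r e g]}.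
  move=> g gl; have gs : g \in s by rewrite (perm_mem ps) !inE gl !orbT.
  have [eg fg] : e != g /\ f != g.
    move: ul; rewrite /= inE negb_or => /andP[/andP[_ h1] /andP[h2 _]].
    by split; [apply: contraNneq h1 => -> | apply: contraNneq h2 => ->].
  split; [exact: hs | exact: eg | apply/negP => ng].
  by have := count_ge2 fs gs fg nf ng; rewrite ltnNge cn.
have bound g : g \in l -> (cnt0 [:: g; e] [:: f])%:R <= F0 [:: e] / 8.
  move=> /hl[cg eg ng].
  have f0 : f != set0 by rewrite -card_gt0 cf (ltn_trans _ r_gt2).
  have := F0_cons hS0 k_gt0 [:: g; e] f0.
  (* As [f] meets at most two components, it is monochromatic in at least half of the colorings that
     make [g] and [e] monochromatic. *)
  have : (#|bmap [:: g; e] @: f| <= 2)%N.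
    by apply: leq_trans (card_bmap_cons _ _ _) _; rewrite card_bmap_near.
  have le := F0_far ce cg eg ng; have := cnt_cons (fun=> S0) [:: g; e] f [::].
  move/(congr1 (fun n => n%:R : rat)); rewrite natrD -/(F0 [:: f; g; e]) -/(F0 [:: g; e]).
  have p0 := F0_ge0 S0 [:: f; g; e].
  case: #|_| => [|[|[|//]]] E _ /=; rewrite ?expr0 ?expr1 ?mulr1 ?k2 => E'; lra.
have hm : F0 [:: e] / 2 = (cnt0 [:: e] [:: f])%:R.
  have := cnt_cons (fun=> S0) [:: e] f [::].
  move/(congr1 (fun n => n%:R : rat)); rewrite natrD -/(F0 [:: f; e]) -/(F0 [:: e]).
  rewrite F0_near //; lra.
have key : (cnt0 [:: e] [:: f])%:R <= \sum_(g <- l) (cnt0 [:: g; e] [:: f])%:R +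
   \sum_(psi | lcol0 psi) (mono psi e && (count (mono psi) s == 1%N))%:R :> rat.
  rewrite cnt_sum; under [X in _ <= X + _]eq_bigr => g _ do rewrite cnt_sum.
  rewrite exchange_big /= -big_split /=; apply: ler_sum => psi _.
  rewrite (seq.permP ps) /= !andbT !orbF.
  case: (boolP (mono psi e)) => me /=; last by rewrite addr_ge0 ?sumr_ge0.
  case: (boolP (mono psi f)) => mf /=; first by rewrite addr_ge0 ?sumr_ge0.
  case: (boolP (has (mono psi) l)) => [/hasP[g gl mg]|].
    by rewrite (big_rem g) //= mg -addrA lerDl addr_ge0 ?sumr_ge0.
  by rewrite has_count -eqn0Ngt => /eqP ->; rewrite lerDr sumr_ge0.
have : \sum_(g <- l) (cnt0 [:: g; e] [:: f])%:R <= 3 * (F0 [:: e] / 8).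
  apply: (@le_trans _ _ (\sum_(g <- l) F0 [:: e] / 8)).
    by rewrite big_seq [leRHS]big_seq; apply: ler_sum.
  by rewrite big_const_seq count_predT sl iter_addr_0 mulr_natl.
move: key; rewrite -hm; lra.
Qed.

(** Given that [e] is monochromatic, the expected number of monochromatic edges is at most
    [1 + 4 / 4 = 2] without near edges. A near edge adds [1 / 4], offset by twice the probability
    [1 / 8] of [lonely_edge]. *)
Lemma edge_excess e s : uniq s -> {in s, forall g : {set V}, #|g| = r} ->
  size s = 5%N -> e \in s -> (count (near r e) s <= 1)%N ->
  0 <= \sum_(psi | lcol0 psi) (mono psi e)%:R *
     (2 - (count (mono psi) s)%:R + 2 * (count (mono psi) s == 1%N)%:R) :> rat.
Proof.
move=> us hs s5 es cn; have ce := hs e es.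
have F0s : F0 [:: e] = \sum_(psi | lcol0 psi) (mono psi e)%:R.
  by rewrite /F0 cnt_sum; apply: eq_bigr => psi _; rewrite /= !andbT.
pose S1 : rat := \sum_(psi | lcol0 psi) (mono psi e && (count (mono psi) s == 1%N))%:R.
pose S2 : rat := \sum_(f <- s) F0 [:: f; e].
have -> : \sum_(psi | lcol0 psi) (mono psi e)%:R *
     (2 - (count (mono psi) s)%:R + 2 * (count (mono psi) s == 1%N)%:R)
   = 2 * F0 [:: e] - S2 + 2 * S1.
  rewrite F0s /S2; under [\sum_(f <- s) _]eq_bigr => f _ do rewrite /F0 cnt_sum.
  rewrite exchange_big /= /S1 !mulr_sumr -sumrB -big_split /=; apply: eq_bigr => psi _.
  have -> : \sum_(f <- s) (mono psi f && (mono psi e && true) && true)%:R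
     = (mono psi e)%:R * (count (mono psi) s)%:R :> rat.
    rewrite -sum1_count natr_sum mulr_sumr [RHS]big_mkcond /=; apply: eq_bigr => f _.
    by case: (mono psi f); case: (mono psi e); rewrite ?mulr1.
  by case: (mono psi e); rewrite /=; ring.
have w0 := F0_ge0 S0 [:: e].
have hS2 : S2 <= F0 [:: e] * (2 + (count (near r e) s)%:R / 4).
  rewrite /S2 (big_rem e) //=.
  have -> : F0 [:: e; e] = F0 [:: e].
    by rewrite /F0; congr (_%:R); apply: eq_card => th; rewrite !inE /=; case: (mono th e).
  have cr : count (near r e) s = count (near r e) (rem e s).
    by rewrite (seq.permP (perm_to_rem es)) /= near_irr //; lia.
  apply: (@le_trans _ _ (F0 [:: e] + \sum_(f <- rem e s)
      F0 [:: e] * (1 / 4 + (near r e f)%:R / 4))).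
    rewrite lerD2l big_seq [leRHS]big_seq; apply: ler_sum => f.
    rewrite mem_rem_uniq // inE => /andP[fe fs].
    case: (boolP (near r e f)) => nf /=; first by rewrite F0_near ?hs //; lra.
    by have := F0_far ce (hs f fs) _ nf; rewrite eq_sym fe => /(_ isT); lra.
  rewrite -mulr_sumr big_split /= big_const_seq count_predT size_rem // s5 iter_addr_0.
  rewrite -mulr_suml -natr_sum cr (_ : (\sum_(f <- rem e s) near r e f)%N
     = count (near r e) (rem e s)); last first.
    by rewrite -sum1_count [RHS]big_mkcond; apply: eq_bigr => f _; case: near.
  rewrite le_eqVlt; apply/orP; left; apply/eqP.
  by rewrite (_ : 1 / 4 *+ 5.-1 = 1 :> rat) //; field.
have S10 : 0 <= S1 by apply: sumr_ge0.
have [c0'|cpos] := posnP (count (near r e) s); first by rewrite c0' in hS2; lra.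
have /hasP[f fs nf] : has (near r e) s by rewrite has_count.
have h := lonely_edge ce us hs s5 es fs nf cn.
have c1 : count (near r e) s = 1%N by apply/eqP; rewrite eqn_leq cn cpos.
by rewrite c1 in hS2; rewrite -/S1 in h; lra.
Qed.

Lemma five_edges_k2 s : uniq s -> {in s, forall e : {set V}, #|e| = r} ->
  size s = 5%N -> {in s, forall e : {set V}, (count (near r e) s <= 1)%N} ->
  0 <= - Lam [::] s.
Proof.
move=> us hs s5 hn.
pose E0 := [seq e <- s | al k L e == 0%N]; pose E1 := [seq e <- s | al k L e != 0%N].
have ps : perm_eq s (E1 ++ E0).
  rewrite perm_sym perm_catC; apply/permPl.
  by have := perm_filterC (fun e => al k L e == 0%N) s.
have E00 : set0 \notin E0.
  by rewrite mem_filter; apply/negP => /andP[_ /hs]; rewrite cards0; lia.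
have hE0 : {in E0, forall f : {set V}, al k L f = 0%N}.
  by move=> f; rewrite mem_filter => /andP[/eqP].
have E1s e : e \in E1 -> [/\ e \in s, e != set0 & (2 * #|com L e| <= k)%N].
  rewrite mem_filter => /andP[ae es].
  have e0 : e != set0 by rewrite -card_gt0 hs //; lia.
  split=> //; have := al_com hL e0; move: ae; lia.
rewrite /Lam opprB subr_ge0.
have c1 (L' : V -> {set T}) : cnt L' [::] s = cnt L' [::] (E1 ++ E0).
  by apply: eq_card => th; rewrite !inE (eq_has_r (perm_mem ps)).
have ub : (cnt L [::] E0)%:R <= (cnt L [::] s)%:R + \sum_(e <- E1) (cnt L [:: e] E0)%:R :> rat.
  by rewrite c1 -natr_sum -natrD ler_nat cnt_union_bound.
(* With two colors per list, a positive deficit leaves at most one common color. *)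
have half : \sum_(e <- E1) (cnt L [:: e] E0)%:R
     <= \sum_(e <- E1) (cnt0 [:: e] E0)%:R / 2 :> rat.
  rewrite big_seq [leRHS]big_seq; apply: ler_sum => e eE.
  have [es e0 ce] := E1s e eE.
  have := cnt_edge_al0 e0 E00 hE0; rewrite ler_pdivlMr // -natrM ler_nat k2 => h.
  by move: ce; rewrite k2; move: h; move: (cnt L _ _) (cnt0 _ _) #|com L e| => a b c h1 h2; nia.
rewrite (cnt_al0 E00 hE0) in ub.
suff main : (cnt0 [::] s)%:R <= (cnt0 [::] E0)%:R - \sum_(e <- E1) (cnt0 [:: e] E0)%:R / 2 :> rat.
  by lra.
rewrite -mulr_suml !cnt_sum.
under [\sum_(e <- E1) _]eq_bigr => e _ do rewrite cnt_sum.
rewrite exchange_big /= mulr_suml -sumrB -subr_ge0 -sumrB.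
(* One sixth of [edge_excess], summed over [E1], reduces the claim to a pointwise inequality. It is
   an equality when one or three edges of [E1] and none of [E0] are monochromatic. *)
have tot : 0 <= \sum_(e <- E1) (\sum_(psi | lcol0 psi) (mono psi e)%:R *
     (2 - (count (mono psi) s)%:R + 2 * (count (mono psi) s == 1%N)%:R)) / 6 :> rat.
  rewrite big_seq; apply: sumr_ge0 => e /E1s[es _ _]; rewrite divr_ge0 //.
  by apply: edge_excess => //; apply: hn.
apply: le_trans tot _; rewrite -mulr_suml exchange_big /= mulr_suml.
apply: ler_sum => psi _.
rewrite -mulr_suml.
have -> : \sum_(e <- E1) (mono psi e)%:R = (count (mono psi) E1)%:R :> rat.
  by rewrite -sum1_count natr_sum [RHS]big_mkcond; apply: eq_bigr => e _; case: mono.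
have -> : \sum_(e <- E1) (mono psi e && true && ~~ has (mono psi) E0)%:R
    = (count (mono psi) E1)%:R * (~~ has (mono psi) E0)%:R :> rat.
  rewrite -sum1_count natr_sum mulr_suml [RHS]big_mkcond; apply: eq_bigr => e _.
  by case: mono; case: has; rewrite ?mulr1 ?mulr0.
rewrite (seq.permP ps) count_cat (eq_has_r (perm_mem ps)) has_cat !has_count.
have : (count (mono psi) E1 <= 5)%N.
  by rewrite -s5 (perm_size ps) size_cat (leq_trans (count_size _ _)) // leq_addr.
have : (count (mono psi) E0 <= 5)%N.
  by rewrite -s5 (perm_size ps) size_cat (leq_trans (count_size _ _)) // leq_addl.
move: (count (mono psi) E1) (count (mono psi) E0) => a [|b] _ ha.
  pose Q (n : nat) := n%:R * (2 - (n + 0)%:R + 2 * ((n + 0)%N == 1%N)%:R) / 6 <=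
    (~~ (0 < 0)%N)%:R - n%:R * (~~ (0 < 0)%N)%:R / 2 - (~~ ((0 < n)%N || (0 < 0)%N))%:R :> rat.
  have /allP h : all Q (iota 0 6) by vm_compute.
  by apply: (h a); rewrite mem_iota.
rewrite orbT mulr0 mul0r !subr0; case: a ha => [|a] _; first by rewrite !mul0r.
rewrite addSn addnS mulr0 addr0; apply: mulr_le0_ge0; last by rewrite invr_ge0.
by apply: mulr_ge0_le0; [exact: ler0n | rewrite subr_le0 ler_nat].
Qed.

End TwoColors.

(** * Numerical bounds on the coefficient *)

Lemma coef_le k m g g' : (0 < k)%N -> (g <= g')%N -> coef k m g' <= coef k m g.
Proof.
move=> k0 gg; rewrite /coef lerB // ler_wpM2l ?ler_nat // subr_ge0.
by rewrite ger_pMr ?invr_gt0 ?ltr0n // invf_le1 ?ltr0n // ler1n.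
Qed.

Lemma coefE k' M' g : let k := k'.+1 in
  coef k M'.+2 g * (2 * k%:R ^+ M'.+2) =
  2 * k%:R ^+ M'.+2 - ((k.+1)%:R ^+ M'.+1 - k'%:R ^+ M'.+1)
    - 2 * g%:R * k'%:R * k%:R ^+ M'.
Proof.
move=> k; rewrite /coef /pp /=.
have k0 : k%:R != 0 :> rat by rewrite pnatr_eq0.
have Ek : k'%:R = k%:R - 1 :> rat by rewrite /k -natr1 addrK.
have -> : 1 + k%:R^-1 = k.+1%:R / k%:R :> rat by rewrite -natr1 mulrDl divff // mul1r.
have -> : 1 - k%:R^-1 = k'%:R / k%:R :> rat by rewrite Ek mulrBl divff // mul1r.
rewrite !expr_div_n !(exprS k%:R) Ek.
have p0 : k%:R ^+ M' != 0 :> rat by rewrite expf_neq0.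
move: (_ ^+ M') p0 (k.+1%:R ^+ M'.+1) ((k%:R - 1) ^+ M'.+1) => p p0 a b.
by field; rewrite k0 p0.
Qed.

Section FiniteCheck.
Local Open Scope N_scope.

(* [2 * den * k ^ (M + 1) * (coef k (M + 1) g - (1 - num / den))] is
   nonnegative, where [k = k' + 1] and [M = M' + 1]. *)
Definition coef_check (num den k' M' g : nat) : bool :=
  let k' := N.of_nat k' in let g := N.of_nat g in
  let M' := N.of_nat M' in let num := N.of_nat num in let den := N.of_nat den in
  let k := N.succ k' in let M := N.succ M' in
  N.leb (den * ((N.succ k) ^ M + 2 * g * k' * k ^ M'))
        (2 * num * k ^ (N.succ M) + den * k' ^ M).

End FiniteCheck.

Lemma N_of_addn (a b : nat) : N.of_nat (a + b)%N = N.add (N.of_nat a) (N.of_nat b).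
Proof. exact: Nat2N.inj_add. Qed.

Lemma N_of_muln (a b : nat) : N.of_nat (a * b)%N = N.mul (N.of_nat a) (N.of_nat b).
Proof. exact: Nat2N.inj_mul. Qed.

Lemma N_of_expn (a b : nat) : N.of_nat (a ^ b)%N = N.pow (N.of_nat a) (N.of_nat b).
Proof.
elim: b => [|b IH]; first by [].
by rewrite expnS N_of_muln IH Nat2N.inj_succ N.pow_succ_r'.
Qed.

Lemma coef_checkP num den k' M' g : (0 < den)%N -> coef_check num den k' M' g ->
  1 - num%:R / den%:R <= coef k'.+1 M'.+2 g.
Proof.
move=> den0 /N.leb_le h.
have {}h : (den * (k'.+2 ^ M'.+1 + 2 * g * k' * k'.+1 ^ M')
   <= 2 * num * k'.+1 ^ M'.+2 + den * k' ^ M'.+1)%N.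
  set lhs := (den * _)%N; set rhs := (_ + _)%N.
  have : N.le (N.of_nat lhs) (N.of_nat rhs).
    rewrite /lhs /rhs !(N_of_addn, N_of_muln, N_of_expn).
    by rewrite !(Nat2N.inj_succ k', Nat2N.inj_succ k'.+1, Nat2N.inj_succ M', Nat2N.inj_succ M'.+1).
  by move: lhs rhs => a b; lia.
move: h; rewrite -(ler_nat rat) !(natrD, natrM, natrX).
have p0 : 0 < 2 * k'.+1%:R ^+ M'.+2 :> rat by rewrite mulr_gt0 // exprn_gt0 // ltr0n.
have d0 : 0 < den%:R :> rat by rewrite ltr0n.
have E : num%:R = num%:R / den%:R * den%:R :> rat by rewrite divfK // gt_eqF.
rewrite {1}E => h; rewrite -(ler_pM2r p0) coefE -(ler_pM2l d0).
move: h; move: (num%:R / den%:R : rat) (den%:R : rat) => q a; lra.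
Qed.

(** The largest [g] with [5 * g <= 4 * M] and [6 * M + 5 * g <= 10 * k + t], where [M] stands for
    [m - 1]. The slack [t] is [0] for [k] at least the bound and [9] for [k] at least its floor. *)
Definition gmax (t k M : nat) := minn (4 * M %/ 5) ((10 * k + t - 6 * M) %/ 5).

(** The coefficient decreases in [g], so testing the largest [g] suffices. For [k <= 48] and
    [t <= 9] the constraints force [M <= 81], within the tested range from [4] to [93]. *)
Lemma coef_small (t num den : nat) (skip : nat -> nat -> bool) :
  (0 < den)%N ->
  all (fun k' => all (fun M' => (10 * k'.+1 + t < 6 * M'.+1)%N || skip k'.+1 M'.+1
       || coef_check num den k' M' (gmax t k'.+1 M'.+1)) (iota 3 90)) (iota 0 48) ->
  forall k M g : nat, (0 < k <= 48)%N -> (4 <= M)%N -> (t <= 9)%N ->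
    (6 * M + 5 * g <= 10 * k + t)%N -> (5 * g <= 4 * M)%N -> ~~ skip k M ->
  1 - num%:R / den%:R <= coef k M.+1 g.
Proof.
move=> den0 /allP hall [//|k'] [//|M'] g /andP[_ hk] hM ht h1 h2 ns.
have /hall/allP : k' \in iota 0 48 by rewrite mem_iota.
move/(_ M'); rewrite mem_iota => /(_ ltac:(lia)).
rewrite (negPf ns) orbF ltnNge (leq_trans (leq_addr _ _) h1) /= => /(coef_checkP den0) h.
apply: le_trans h _; apply: coef_le => //.
by rewrite /gmax; lia.
Qed.

(** [1 + 1 / k] is the inverse of [1 - 1 / (k + 1)], whose power is at least [1 / 2] by the
    Bernoulli inequality. *)
Lemma pow_half_le2 k h : (0 < k)%N -> (2 * h <= k.+1)%N -> (1 + k%:R^-1) ^+ h <= 2 :> rat.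
Proof.
move=> k0 hk; have kR : 0 < k%:R :> rat by rewrite ltr0n.
have k1 : 0 < k.+1%:R :> rat by rewrite ltr0n.
have bern : 1 - h%:R / k.+1%:R <= (1 - k.+1%:R^-1) ^+ h :> rat.
  elim: h {hk} => [|h IH]; first by rewrite mul0r subr0 expr0.
  have x0 : 0 <= 1 - k.+1%:R^-1 :> rat by rewrite subr_ge0 invf_le1 // ler1n.
  rewrite exprS; apply: le_trans (ler_wpM2l x0 IH).
  rewrite -(natr1 h) mulrDl mul1r.
  have : 0 <= k.+1%:R^-1 * (h%:R / k.+1%:R) :> rat.
    by rewrite !mulr_ge0 ?invr_ge0 ?ler0n.
  move: (h%:R / k.+1%:R : rat) (k.+1%:R^-1 : rat) => y u; lra.
have E : 1 + k%:R^-1 = (1 - k.+1%:R^-1)^-1 :> rat.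
  rewrite -(natr1 k); move: (k%:R : rat) kR => x x0.
  have x1 : 0 < x + 1 by lra.
  by field; rewrite addrK !gt_eqF.
have b2 : 1 / 2 <= (1 - k.+1%:R^-1) ^+ h :> rat.
  have : h%:R / k.+1%:R <= 1 / 2 :> rat.
    rewrite (ler_pdivrMr _ _ k1); move: hk; rewrite -(ler_nat rat) natrM; lra.
  by move: bern; move: ((1 - k.+1%:R^-1) ^+ h : rat) (h%:R / k.+1%:R : rat) => a b; lra.
have z0 : 0 < (1 - k.+1%:R^-1) ^+ h :> rat by apply: lt_le_trans b2.
by rewrite E exprVn -[leRHS]invrK lef_pV2 ?posrE ?invr_gt0 // -div1r.
Qed.

(** The constraints give [25 * g <= 20 * k + 18], and [(1 + 1 / k) ^ M <= 2 ^ 4] bounds the odd part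
    by [8]. The least integer [k] with [1 - 8 / k - 4 / 5 - 18 / (25 * k) >= 1 / 50] is [49]. *)
Lemma coef_large k M g : (49 <= k)%N -> (6 * M + 5 * g <= 10 * k + 9)%N ->
  (5 * g <= 4 * M)%N -> 1 / 50 <= coef k M.+1 g.
Proof.
move=> k49 h1 h2; have k0 : (0 < k)%N by lia.
have kR : 0 < k%:R :> rat by rewrite ltr0n.
pose h := (k.+1 %/ 2)%N.
have x1 : 1 <= 1 + k%:R^-1 :> rat by rewrite lerDl invr_ge0 ltW.
have pw : (1 + k%:R^-1) ^+ M <= 16 :> rat.
  apply: (@le_trans _ _ ((1 + k%:R^-1) ^+ (h * 4))).
    by rewrite ler_weXn2l // /h; lia.
  rewrite exprM (_ : 16 = 2 ^+ 4 :> rat) //.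
  rewrite lerXn2r ?nnegrE ?exprn_ge0 ?(le_trans _ x1) //.
  by apply: pow_half_le2 => //; rewrite /h; lia.
have q0 : 0 <= (1 - k%:R^-1) ^+ M :> rat.
  by rewrite exprn_ge0 // subr_ge0 invf_le1 // ler1n.
have gk : 25 * g%:R <= 20 * k%:R + 18 :> rat.
  have : (25 * g <= 20 * k + 18)%N by lia.
  by rewrite -(ler_nat rat) natrD !natrM.
have kk : k%:R * k%:R^-1 = 1 :> rat by rewrite divff // gt_eqF.
have u0 : 0 <= k%:R^-1 :> rat by rewrite invr_ge0 ltW.
have u49 : 49 * k%:R^-1 <= 1 :> rat.
  rewrite -[leRHS]kk; apply: ler_wpM2r; first exact: u0.
  by rewrite ler_nat; exact: k49.
have g0 : 0 <= g%:R :> rat by exact: ler0n.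
rewrite /coef /pp /=.
move: pw q0; move: ((1 + k%:R^-1) ^+ M) ((1 - k%:R^-1) ^+ M) => a b pw q0.
have ga : 25 * (g%:R * k%:R^-1) <= 20 * (k%:R * k%:R^-1) + 18 * k%:R^-1 :> rat.
  by have := ler_wpM2r u0 gk; lra.
rewrite kk in ga.
have gu : 0 <= k%:R^-1 * k%:R^-1 * g%:R :> rat by rewrite !mulr_ge0.
have ua : k%:R^-1 * a <= k%:R^-1 * 16 :> rat by rewrite ler_wpM2l.
have ub : 0 <= k%:R^-1 * b :> rat by rewrite mulr_ge0.
move: (k%:R^-1 : rat) u49 u0 ga gu ua ub => u; lra.
Qed.

Lemma coef_ge k M g : (4 <= M)%N -> (6 * M + 5 * g <= 10 * k)%N -> (5 * g <= 4 * M)%N ->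
  1 / 50 <= coef k M.+1 g.
Proof.
move=> hM h1 h2; have [k48|k49] := leqP k 48; last by apply: coef_large => //; lia.
have -> : 1 / 50 = 1 - 49%:R / 50%:R :> rat by field.
apply: (@coef_small 0 49 50 (fun _ _ => false) isT).
- by vm_compute.
- by lia.
- exact: hM.
- exact: isT.
- by rewrite addn0.
- exact: h2.
- exact: isT.
Qed.

Lemma coef_ge0 k M g : (4 <= M)%N -> (6 * M + 5 * g <= 10 * k + 9)%N ->
  (5 * g <= 4 * M)%N -> (M != 4%N) || (k != 2%N) && ((k != 3%N) || (g <= 2)%N) ->
  0 <= coef k M.+1 g.
Proof.
move=> hM h1 h2 h3; have [k48|k49] := leqP k 48; last first.
  apply: le_trans (coef_large k49 h1 h2); lra.
(* Here [gmax] is [3], where the coefficient is negative, so the table skips this pair and [g = 2]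
   is evaluated directly. *)
case: (boolP ((M == 4%N) && (k == 3%N))) => [/andP[/eqP M4 /eqP k3]|ns].
  rewrite M4 k3 in h3 *; apply: le_trans (@coef_le 3 5 g 2 isT h3).
  by vm_compute.
have -> : 0 = 1 - 1%:R / 1%:R :> rat by rewrite divff ?subrr.
apply: (@coef_small 9 1 1 (fun k M => (M == 4) && ((k == 2) || (k == 3))) isT).
- by vm_compute.
- by lia.
- exact: hM.
- exact: isT.
- exact: h1.
- exact: h2.
- by move: h3 ns; case: (M == 4%N); rewrite //= => /andP[h _]; rewrite (negPf h).
Qed.

(** * From lists of naturals to a finite palette *)

Lemma card_ord_fset (N : nat) (A : {fset nat}) : {in A, forall c, (c < N)%N} ->
  #|[set c : 'I_N | val c \in A]| = #|` A|.
Proof.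
move=> hA; rewrite cardE -(size_map val).
apply: perm_size; apply: uniq_perm.
- by rewrite map_inj_uniq ?enum_uniq //; apply: val_inj.
- exact: fset_uniq.
move=> c; apply/mapP/idP => [[x]|cA].
  by rewrite mem_enum inE => xA ->.
by exists (Ordinal (hA c cA)) => //; rewrite mem_enum inE.
Qed.

Section Translate.
Variables (H : hypergraph) (k N : nat).
Hypothesis kN : (k <= N)%N.
Implicit Types (e : {set H}).

Definition base_set : {set 'I_N} := [set c : 'I_N | (c < k)%N].

Definition ord_list (L : assignment H) v : {set 'I_N} := [set c : 'I_N | val c \in L v].

Lemma widen_inj : injective (widen_ord kN).
Proof. by move=> a b /(congr1 val) /= /val_inj. Qed.

Lemma card_base_set : #|base_set| = k.
Proof.
rewrite -[RHS]card_ord -(card_imset _ widen_inj).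
apply: eq_card => c; rewrite inE; apply/idP/imsetP => [ck|[x _ ->]]; last exact: (ltn_ord x).
by exists (Ordinal ck) => //; apply: val_inj.
Qed.

Lemma edge_neq0 e : e \in edges H -> e != set0.
Proof. by move=> /edge_card; rewrite -card_gt0; apply: ltnW. Qed.

(** Only the pattern of equal colors matters, so one lemma serves colorings in ['I_k] and dependent
    colorings from the lists. *)
Lemma proper_mono (C : choiceType) (theta : H -> C) (th : {ffun H -> 'I_N})
    (s : seq {set H}) : s =i edges H ->
  (forall u v, (theta u == theta v) = (th u == th v)) ->
  proper_coloring theta = ~~ has (mono th) s.
Proof.
move=> hs hth; rewrite -all_predC.
have key e : e \in edges H -> (1 < #|` [fset theta v | v in e]%fset|)%N = ~~ mono th e.
  move=> /edge_neq0/set0Pn[u ue]; rewrite ltnNge; congr (~~ _).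
  apply/idP/monoP => [le1 a b ae be|m].
    apply/eqP; rewrite -hth; apply/eqP.
    have [ia ib] : theta a \in [fset theta v | v in e]%fset /\
        theta b \in [fset theta v | v in e]%fset by split; apply: in_imfset.
    move: le1; rewrite leq_eqVlt ltnS leqn0 => /orP[/cardfs1P[x E]|].
      by move: ia ib; rewrite E !inE => /eqP -> /eqP ->.
    by rewrite cardfs_eq0 => /eqP E; rewrite E in ia.
  have -> : [fset theta v | v in e]%fset = [fset theta u]%fset.
    apply/fsetP => x; rewrite inE; apply/imfsetP/eqP => [[v /= ve ->]|->].
      by apply/eqP; rewrite hth; apply/eqP/m.
    by exists u.
  by rewrite cardfs1.
apply/forall_inP/allP => [h e es|h e eE].
  by rewrite /= -key; [apply: h|]; rewrite -hs.
by rewrite key //; apply: h; rewrite hs.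
Qed.

Lemma P_cnt (s : seq {set H}) : s =i edges H ->
  P H k = cnt (fun=> base_set) [::] s.
Proof.
move=> hs; pose g (theta : {ffun H -> 'I_k}) : {ffun H -> 'I_N} :=
  [ffun v => widen_ord kN (theta v)].
have ginj : injective g.
  move=> a b /ffunP E; apply/ffunP => v; have := E v; rewrite !ffunE.
  exact: widen_inj.
rewrite /P -(card_imset _ ginj); apply: eq_card => th.
rewrite [RHS]inE /=; apply/imsetP/andP => [[theta]|[/forallP hth pr]].
  rewrite inE => pr ->; split.
    by apply/forallP => v; rewrite inE ffunE /= ltn_ord.
  rewrite -(proper_mono (theta := theta) hs) // => u v; rewrite !ffunE.
  by rewrite (inj_eq widen_inj).
have hk v : (th v < k)%N by have := hth v; rewrite inE.
have gE : g [ffun v => Ordinal (hk v)] = th.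
  by apply/ffunP => v; rewrite !ffunE; apply: val_inj.
exists [ffun v => Ordinal (hk v)] => //.
rewrite inE (proper_mono (th := th) hs) // => u v; rewrite !ffunE.
by rewrite -!val_eqE.
Qed.

Variable L : assignment H.
Hypothesis LN : forall v, {in L v, forall c, (c < N)%N}.

Lemma card_ord_list v : #|ord_list L v| = #|` L v|.
Proof. exact: card_ord_fset. Qed.

Lemma P_list_cnt (s : seq {set H}) : s =i edges H ->
  P_list L = cnt (ord_list L) [::] s.
Proof.
move=> hs; pose g (theta : {dffun forall v : H, L v}) : {ffun H -> 'I_N} :=
  [ffun v => Ordinal (LN (valP (theta v)))].
have ginj : injective g.
  move=> a b /ffunP E; apply/ffunP => v; have := E v; rewrite !ffunE.
  by move/(congr1 val) => /= /val_inj.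
rewrite /P_list -(card_imset _ ginj); apply: eq_card => th.
rewrite [RHS]inE /=; apply/imsetP/andP => [[theta]|[/forallP hth pr]].
  rewrite inE => pr ->; split.
    by apply/forallP => v; rewrite inE ffunE /= (valP (theta v)).
  by rewrite -(proper_mono (theta := fun v => val (theta v)) hs) // => u v; rewrite !ffunE.
have hk v : val (th v) \in L v by have := hth v; rewrite inE.
pose theta : {dffun forall v : H, L v} := finfun (fun v => FSetSub (hk v) : L v).
have gE : g theta = th.
  by apply/ffunP => v; rewrite !ffunE; apply: val_inj.
exists theta => //.
by rewrite inE (proper_mono (th := th) hs) // => u v; rewrite /theta !ffunE -val_eqE.
Qed.

Lemma alpha_edge_al e : e \in edges H -> alpha_edge k L e = al k (ord_list L) e.
Proof.
move=> /edge_neq0/set0Pn[u ue]; rewrite /alpha_edge /al; congr (_ - _)%N.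
have hc c : (c \in common L e) = [forall v in e, c \in L v].
  rewrite !inE /= andb_idl // => /forall_inP h.
  by apply/bigfcupP; exists u; rewrite ?mem_index_enum ?ue // h.
rewrite -(@card_ord_fset N).
  apply: eq_card => c; rewrite !in_set hc; apply: eq_forallb_in => v _.
  by rewrite inE.
by move=> c; rewrite hc => /forall_inP/(_ u ue); apply: LN.
Qed.

End Translate.

(** * Consequences for hypergraphs, and the threshold *)

Section Hypergraphs.
Variables (H : hypergraph) (m r : nat).
Hypothesis hm : #|edges H| = m.
Hypothesis hH : uniform H r.
Hypothesis hr : (2 < r)%N.
Implicit Types (e : {set H}).

Lemma assignment_bound (L : assignment H) :
  exists N : nat, forall v, {in L v, forall c, (c < N)%N}.
Proof.
exists (\max_(v : H) \max_(c <- L v) c).+1 => v c cL; rewrite ltnS.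
apply: leq_trans (leq_bigmax_cond (F := fun v => \max_(c <- L v) c) v isT).
by rewrite (big_rem c) //= leq_maxl.
Qed.

Lemma count_near_le e : e \in edges H -> forall s, perm_eq s (enum (edges H)) ->
  (count (near r e) s <= gamma H r)%N.
Proof.
move=> eE s /seq.permP ->.
apply: leq_trans (leq_bigmax_cond (F := fun e => #|E_near r e|) e eE).
rewrite -size_filter /E_near cardE.
apply: uniq_leq_size; first by rewrite filter_uniq ?enum_uniq.
by move=> f; rewrite mem_filter !mem_enum !inE /near subn1 andbC.
Qed.

(** The palette of size [N0 + k] contains all lists and the colors below [k]. The edges are sorted
    by decreasing deficit for the sake of [five_edges_k3]. *)
Lemma compare_lists k (L : assignment H) : (0 < k)%N -> k_assignment k L ->
  exists T : finType, exists Lp : H -> {set T}, exists S0 : {set T},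
  exists c0 : T, exists s : seq {set H},
  [/\ [/\ forall v, #|Lp v| = k, #|S0| = k & c0 \in S0],
      [/\ perm_eq s (enum (edges H)),
          pairwise (fun e f => al k Lp f <= al k Lp e)%N s,
          {in edges H, forall e, alpha_edge k L e = al k Lp e}
        & {in s, forall e, #|e| = r}]
    & (P_list L)%:R - (P H k)%:R = - Lam Lp S0 [::] s].
Proof.
move=> k0 kL; have [N0 hN0] := assignment_bound L.
pose N := (N0 + k)%N; have kN : (k <= N)%N by apply: leq_addl.
have LN v : {in L v, forall c, (c < N)%N}.
  by move=> c /hN0 h; apply: leq_trans h (leq_addr _ _).
pose Lp := ord_list N L; pose S0 := base_set k N.
have N0' : (0 < N)%N by apply: leq_trans kN.
pose s := sort (fun e f => al k Lp f <= al k Lp e)%N (enum (edges H)).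
have ps : perm_eq s (enum (edges H)) by rewrite perm_sort.
have hs : s =i edges H by move=> e; rewrite (perm_mem ps) mem_enum.
exists 'I_N, Lp, S0, (Ordinal N0'), s; split; [split|split|].
- by move=> v; rewrite /Lp card_ord_list.
- exact: card_base_set.
- by rewrite inE.
- exact: ps.
- rewrite -sorted_pairwise; last by move=> a b c h1 h2; apply: leq_trans h2 h1.
  by apply: sort_sorted => a b; apply: leq_total.
- by move=> e eE; apply: alpha_edge_al.
- by move=> e; rewrite hs => /hH.
by rewrite /Lam opprB (P_cnt kN hs) (P_list_cnt LN hs).
Qed.

Lemma alpha_lower_bound k (L : assignment H) (c : rat) :
  (0 < k)%N -> k_assignment k L -> c <= coef k m (gamma H r) ->
  c * k%:R ^+ (#|H| - r) * (alpha k L)%:R <= (P_list L)%:R - (P H k)%:R.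
Proof.
move=> k0 kL hc.
have [T [Lp [S0 [c0 [s [[hL hS0 hc0] [ps _ hal hs] ->]]]]]] := compare_lists k0 kL.
have us : uniq s by rewrite (perm_uniq ps) enum_uniq.
have sm : size s = m by rewrite (perm_size ps) -cardE.
apply: le_trans (main_lin hL hS0 k0 hr hc0 us hs).
rewrite mulrAC [X in X <= _]mulrC ler_wpM2l ?exprn_ge0 ?ler0n //.
rewrite /alpha /total natr_sum mulr_sumr -big_enum /= -(perm_big _ ps) /=.
rewrite big_seq [leRHS]big_seq; apply: ler_sum => e es.
have eE : e \in edges H by rewrite -mem_enum -(perm_mem ps).
rewrite hal // mulrC ler_wpM2l ?ler0n // sm; apply: le_trans hc _.
by apply: coef_le => //; apply: count_near_le.
Qed.

(** The slack [9] is what rounding the bound down allows. The parameters that [coef_ge0] excludes go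
    to [five_edges_k2] and [five_edges_k3]. *)
Lemma P_list_ge k (L : assignment H) : (4 < m)%N -> (5 * gamma H r <= 4 * m.-1)%N ->
  (6 * m.-1 + 5 * gamma H r <= 10 * k + 9)%N -> k_assignment k L -> (P H k <= P_list L)%N.
Proof.
move=> m5 g1 g2 kL; have k0 : (0 < k)%N by lia.
rewrite -(ler_nat rat) -subr_ge0.
have [T [Lp [S0 [c0 [s [[hL hS0 hc0] [ps hp _ hs] E]]]]]] := compare_lists k0 kL.
have us : uniq s by rewrite (perm_uniq ps) enum_uniq.
have sm : size s = m by rewrite (perm_size ps) -cardE.
have near_le g : (gamma H r <= g)%N -> {in s, forall e, (count (near r e) s <= g)%N}.
  move=> gg e es; apply: leq_trans gg; apply: count_near_le => //.
  by rewrite -mem_enum -(perm_mem ps).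
have [h|] := boolP ((m.-1 != 4%N) || (k != 2%N) && ((k != 3%N) || (gamma H r <= 2)%N)).
  have := @alpha_lower_bound k L 0 k0 kL; rewrite !mul0r; apply.
  by rewrite -[m]prednK ?(ltn_trans _ m5) //; apply: coef_ge0 => //; lia.
rewrite negb_or negbK negb_and negbK => /andP[/eqP m4 h].
have s5 : size s = 5%N by lia.
rewrite E; case/orP: h => [/eqP k2|h].
  by apply: (five_edges_k2 hL hS0 k0 hc0 hr k2 us hs s5); apply: near_le; lia.
have k3 : k = 3%N by move: h; rewrite negb_or negbK => /andP[/eqP].
by apply: (five_edges_k3 hL hS0 k0 hc0 hr us hs hp k3 s5); apply: near_le; lia.
Qed.

(** The constant assignment with the colors below [k] attains [P H k]. *)
Lemma P_l_eq k : (forall L : assignment H, k_assignment k L -> P H k <= P_list L)%N ->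
  P_l H k = P H k.
Proof.
move=> hge; rewrite /P_l; case: ex_minnP => p /asboolP[L kL <-] hmin.
apply/eqP; rewrite eqn_leq hge // andbT; apply: hmin; apply/asboolP.
pose L0 : assignment H := fun=> [fset i in iota 0 k]%fset.
have L0E v i : (i \in L0 v) = (i < k)%N by rewrite !inE mem_iota.
have hs : enum (edges H) =i edges H by move=> e; rewrite mem_enum.
exists L0.
  by move=> v; rewrite card_fseq undup_id ?iota_uniq // size_iota.
have LN v : {in L0 v, forall c, (c < k)%N} by move=> c; rewrite L0E.
rewrite (P_list_cnt LN hs) (P_cnt (leqnn k) hs).
apply: eq_card => th; rewrite !in_set; congr (_ && _); apply: eq_forallb => v.
by rewrite !in_set L0E.
Qed.

End Hypergraphs.

Theorem theorem1p3 (H : hypergraph) (n m r : nat)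
    (hn : #|H| = n) (hm : #|edges H| = m) (hH : uniform H r)
    (hr : (3 <= r)%N) (hm5 : (5 <= m)%N)
    (hgamma : (gamma H r)%:R <= 4 / 5 * (m%:R - 1) :> rat) :
  let bound : rat := 3 / 5 * (m%:R - 1) + 1 / 2 * (gamma H r)%:R in
  (forall k : nat, bound <= k%:R ->
     forall L : assignment H, k_assignment k L ->
       1 / 50 * k%:R ^+ (n - r) * (alpha k L)%:R
         <= (P_list L)%:R - (P H k)%:R :> rat) /\
  (exists q : nat,
     is_tau' H q /\ q%:R <= bound /\ bound <= m%:R - 1).
Proof.
set g := gamma H r => bound.
have mE : m%:R = m.-1%:R + 1 :> rat by rewrite natr1 prednK // (ltn_trans _ hm5).
have g1 : (5 * g <= 4 * m.-1)%N.
  by rewrite -(ler_nat rat) !natrM; move: hgamma; rewrite mE; lra.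
have m4 : (4 <= m.-1)%N by move: hm5; case: (m).
have bE : 10 * bound = (6 * m.-1 + 5 * g)%:R :> rat.
  by rewrite /bound mE natrD !natrM; field.
have bm : bound <= m%:R - 1 :> rat.
  by move: hgamma; rewrite /bound -/g; move: (m%:R : rat) (g%:R : rat) => x y; lra.
clearbody bound; split=> [k hk L kL|].
  have hk10 : (6 * m.-1 + 5 * g <= 10 * k)%N.
    by rewrite -(ler_nat rat) -bE natrM ler_wpM2l ?ler0n.
  have k0 : (0 < k)%N by lia.
  rewrite -hn; apply: (alpha_lower_bound hm hH hr k0 kL).
  have -> : m = m.-1.+1 by lia.
  exact: coef_ge.
(* The least threshold must not exceed the bound, so the floor of the bound, not its ceiling, has to
   be a threshold. *)
pose q0 := ((6 * m.-1 + 5 * g) %/ 10)%N.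
have tq0 : threshold H q0.
  split; first by rewrite /q0; lia.
  move=> k qk; apply: P_l_eq => L kL; apply: (@P_list_ge H m r) => //.
  by move: qk; rewrite /q0 -/g; lia.
have ex : exists q, `[< threshold H q >] by exists q0; apply/asboolP.
exists (ex_minn ex); case: ex_minnP => q /asboolP tq qmin; split.
  by split=> // q' tq'; apply: qmin; apply/asboolP.
split; last exact: bm.
have : (10 * q <= 6 * m.-1 + 5 * g)%N.
  have : (q <= q0)%N by apply: qmin; apply/asboolP.
  by rewrite /q0; lia.
by rewrite -(ler_nat rat) -bE natrM ler_pM2l ?ltr0n.
Qed.
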